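(* Scheduling the jobs in non-increasing $w_j$ order is a 3-approximation algorithm for $1|nr=1,p_j=1,w_j=a_j|\sum w_jC_j$. That is, for every instance of single machine scheduling with one non-renewable resource (with an arbitrary number $q$ of supplies) in which every job has unit processing time $p_j=1$ and its weight equals its resource requirement, $w_j=a_j$, list scheduling the jobs in non-increasing order of $w_j$ is a polynomial time algorithm producing a feasible schedule whose total weighted completion time $\sum_j w_jC_j$ is at most $3\cdot OPT$, where $OPT$ is the minimum of $\sum_j w_jC_j$ over all feasible schedules.
   Context: Scheduling model. A finite set $\mathcal{J}$ of $n$ jobs is to be processed without preemption on a single machine that processes at most one job at a time. Job $j$ has processing time $p_j>0$, weight $w_j>0$, and resource requirement $a_j\ge 0$ from a single non-renewable resource. The resource is supplied at $q\ge1$ known time points $0=u_1<u_2<\dots<u_q$, in quantities $\tilde b_1,\dots,\tilde b_q>0$. A schedule assigns a start time $S_j\ge 0$ to each job; job $j$ occupies the machine during $[S_j,S_j+p_j)$, and its completion time is $C_j=S_j+p_j$. A schedule is feasible if the jobs do not overlap on the machine and, for every time $t\ge0$, $\sum_{j: S_j\le t} a_j\le\sum_{\ell: u_\ell\le t}\tilde b_\ell$. It is assumed that the total requirement equals the total supply, $\sum_{j}a_j=\sum_{\ell=1}^q\tilde b_\ell$. The numerical data are rational numbers encoded in binary, with each job listed individually in the input. List scheduling in a given job order: the jobs are processed in exactly that order (ties in the order broken arbitrarily), each job being started as early as possible, i.e., at the earliest time that is not before the completion time of the preceding job in the order and at which the total supply received so far is at least the total requirement of this job and all jobs preceding it in the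 order. *)

(* Defs.v *)
From mathcomp Require Import all_boot all_order all_algebra all_fingroup.
From mathcomp Require Import reals.

Set Implicit Arguments.
Unset Strict Implicit.
Unset Printing Implicit Defensive.

Import Order.TTheory GRing.Theory Num.Theory.

Local Open Scope ring_scope.

(** * Single machine scheduling with one non-renewable resource *)

Record instance := Instance {
  njobs : nat;
  proc : 'I_njobs -> rat;
  weight : 'I_njobs -> rat;
  req : 'I_njobs -> rat;
  nsupplies : nat;
  supply_time : 'I_nsupplies -> rat;
  supply_qty : 'I_nsupplies -> rat;
  proc_gt0 : forall j, 0 < proc j;
  weight_gt0 : forall j, 0 < weight j;
  req_ge0 : forall j, 0 <= req j;
  nsupplies_gt0 : (0 < nsupplies)%N;
  supply_time0 : supply_time (Ordinal nsupplies_gt0) = 0;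
  supply_time_incr : forall l m : 'I_nsupplies,
    (l < m)%N -> supply_time l < supply_time m;
  supply_qty_gt0 : forall l, 0 < supply_qty l;
  req_eq_supply : \sum_j req j = \sum_l supply_qty l
}.

Section Schedules.
Variables (R : realType) (I : instance).

Definition schedule := 'I_(njobs I) -> R.

Definition completion (S : schedule) j : R := S j + ratr (proc j).

Definition supplied (t : R) : R :=
  \sum_(l : 'I_(nsupplies I) | ratr (supply_time l) <= t) ratr (supply_qty l).

Definition feasible (S : schedule) : Prop :=
  [/\ forall j, 0 <= S j,
      forall (t : R) i j,
        S i <= t < completion S i -> S j <= t < completion S j -> i = j
    & forall t : R, 0 <= t -> \sum_(j | S j <= t) ratr (req j) <= supplied t].

Definition total_weighted_completion (S : schedule) : R :=
  \sum_j ratr (weight j) * completion S j.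

Definition is_optimum (opt : R) : Prop :=
  (exists2 S, feasible S & total_weighted_completion S = opt) /\
  (forall S, feasible S -> opt <= total_weighted_completion S).

Definition feasible_within_factor (alpha : R) (S : schedule) : Prop :=
  feasible S /\
  exists2 opt, is_optimum opt & total_weighted_completion S <= alpha * opt.

(** A job order is a permutation [s]; [s k] is the job in position [k]. *)

Definition may_start (s : 'S_(njobs I)) (S : schedule) (k : 'I_(njobs I))
    (t : R) : Prop :=
  [/\ 0 <= t,
      forall i : 'I_(njobs I), i.+1 = k :> nat -> completion S (s i) <= t
    & \sum_(i < njobs I | (i <= k)%N) ratr (req (s i)) <= supplied t].

Definition is_list_schedule (s : 'S_(njobs I)) (S : schedule) : Prop :=
  forall k, may_start s S k (S (s k)) /\
            (forall t, may_start s S k t -> S (s k) <= t).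

End Schedules.

Definition non_increasing_weight (I : instance) (s : 'S_(njobs I)) : Prop :=
  forall i k : 'I_(njobs I), (i <= k)%N -> weight (s k) <= weight (s i).

Definition unit_proc_weight_eq_req (I : instance) : Prop :=
  (forall j : 'I_(njobs I), proc j = 1) /\
  (forall j : 'I_(njobs I), weight j = req j).

(** * Polynomial time

    Programs are while programs over finitely many variables holding binary
    trees with integer leaves, with logarithmic (bit) cost: each evaluation of
    an expression is charged the size, in bits, of the values of all its
    subexpressions.  Since every primitive is computable in time polynomial in
    the size of its operands, polynomial time in this model is polynomial time
    on Turing machines. *)

Inductive value := Int of int | Pair of value & value.

Definition bits (z : int) : nat := (trunc_log 2 `|z|).+2.

Fixpoint vsize (v : value) : nat :=
  match v with
  | Int z => bits z
  | Pair v1 v2 => (vsize v1 + vsize v2).+1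
  end.

Inductive expr :=
  | Var of nat
  | Const of int
  | Cons of expr & expr
  | Fst of expr
  | Snd of expr
  | IsPair of expr
  | Add of expr & expr
  | Sub of expr & expr
  | Mul of expr & expr
  | Le of expr & expr.

Definition store := nat -> value.

Definition vfst v := if v is Pair v1 _ then v1 else Int 0.
Definition vsnd v := if v is Pair _ v2 then v2 else Int 0.
Definition vint v : int := if v is Int z then z else 0.
Definition vbool (b : bool) := Int (b : nat)%:Z.

Fixpoint eval (st : store) (e : expr) : value :=
  match e with
  | Var x => st x
  | Const z => Int z
  | Cons e1 e2 => Pair (eval st e1) (eval st e2)
  | Fst e1 => vfst (eval st e1)
  | Snd e1 => vsnd (eval st e1)
  | IsPair e1 => vbool (if eval st e1 is Pair _ _ then true else false)
  | Add e1 e2 => Int (vint (eval st e1) + vint (eval st e2))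
  | Sub e1 e2 => Int (vint (eval st e1) - vint (eval st e2))
  | Mul e1 e2 => Int (vint (eval st e1) * vint (eval st e2))
  | Le e1 e2 => vbool (vint (eval st e1) <= vint (eval st e2))
  end.

Fixpoint cost (st : store) (e : expr) : nat :=
  (vsize (eval st e) +
   match e with
   | Var _ | Const _ => 0
   | Fst e1 | Snd e1 | IsPair e1 => cost st e1
   | Cons e1 e2 | Add e1 e2 | Sub e1 e2 | Mul e1 e2 | Le e1 e2 =>
       cost st e1 + cost st e2
   end)%N.

Definition truthy (v : value) : bool := if v is Int z then z != 0 else true.

Inductive cmd :=
  | Assign of nat & expr
  | Seq of cmd & cmd
  | If of expr & cmd & cmd
  | While of expr & cmd.

Definition update (st : store) (x : nat) (v : value) : store :=
  fun y => if y == x then v else st y.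

(** [exec c st st' t]: from [st], [c] halts in [st'] after time [t]. *)

Inductive exec : cmd -> store -> store -> nat -> Prop :=
  | exec_assign x e st :
      exec (Assign x e) st (update st x (eval st e)) (cost st e)
  | exec_seq c1 c2 st st1 st2 t1 t2 :
      exec c1 st st1 t1 -> exec c2 st1 st2 t2 ->
      exec (Seq c1 c2) st st2 (t1 + t2)
  | exec_if e c1 c2 st st' t :
      exec (if truthy (eval st e) then c1 else c2) st st' t ->
      exec (If e c1 c2) st st' (cost st e + t)
  | exec_while_stop e c st :
      ~~ truthy (eval st e) ->
      exec (While e c) st st (cost st e)
  | exec_while_step e c st st1 st2 t1 t2 :
      truthy (eval st e) ->
      exec c st st1 t1 -> exec (While e c) st1 st2 t2 ->
      exec (While e c) st st2 (cost st e + t1 + t2).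

(** Rationals are given in lowest terms, with positive denominator; lists are
    nested pairs ended by the leaf 0.  Jobs and supplies are listed by
    increasing index, and so are the start times in an encoded schedule. *)

Definition enc_rat (x : rat) : value := Pair (Int (numq x)) (Int (denq x)).

Definition enc_list (vs : seq value) : value := foldr Pair (Int 0) vs.

Definition enc_instance (I : instance) : value :=
  Pair
    (enc_list
       [seq Pair (enc_rat (proc j))
              (Pair (enc_rat (weight j)) (enc_rat (req j)))
       | j <- enum 'I_(njobs I)])
    (enc_list
       [seq Pair (enc_rat (supply_time l)) (enc_rat (supply_qty l))
       | l <- enum 'I_(nsupplies I)]).

Definition enc_schedule (I : instance) (S : 'I_(njobs I) -> rat) : value :=
  enc_list [seq enc_rat (S j) | j <- enum 'I_(njobs I)].

(** Input and output are both passed in variable 0. *)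

Definition input_store (v : value) : store :=
  fun x => if x == 0%N then v else Int 0.

Definition outputs_in_time (c : cmd) (I : instance)
    (S : 'I_(njobs I) -> rat) (t : nat) : Prop :=
  exists2 st, exec c (input_store (enc_instance I)) st t
            & st 0%N = enc_schedule S.

(** On every instance of the class [A], [c] outputs, in time polynomial in the
    length of the input, a schedule with property [Q]. *)

Definition poly_time_scheduler (c : cmd) (A : instance -> Prop)
    (Q : forall I : instance, ('I_(njobs I) -> rat) -> Prop) : Prop :=
  exists pol : {poly nat}, forall I, A I ->
    exists S t, [/\ outputs_in_time c S t,
                    (t <= pol.[vsize (enc_instance I)]%R)%N
                  & Q I S].

(* Main.v *)
Require Import Defs.
From mathcomp Require Import all_boot all_order all_algebra all_fingroup.
From mathcomp Require Import reals lra zify.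
(* Imported again because the notation [Cons] of seq hides the constructor. *)
Import Defs.

(** The release time r_k of the k-th job in the order is the first time at which
    the supply covers the requirements of the jobs up to k.  A list schedule of
    unit jobs satisfies C_k <= r_k + k, with k counted from 1.  For
    non-increasing weights, sum_k w_k k <= OPT by rearrangement.  Moreover
    sum_k w_k r_k <= 2 OPT, because at each time t the weight of the jobs with
    r_k > t is at most twice the weight W of the jobs that an optimal schedule
    has not started by t: if k is the first job with r_k > t, then W exceeds
    the total weight of the jobs after k, since weights are requirements, and
    the optimal schedule has not started all of the jobs up to k, so W >= w_k.
    An optimum exists because every feasible schedule is dominated by the list
    schedule of its own order.

    The program avoids sorting: it counts, for each job, the jobs that precede
    it (ties are broken by index), sums their requirements to get the release
    time, and takes the maximum over preceding jobs i of r_i plus the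
    difference of ranks. *)

Set Implicit Arguments.
Unset Strict Implicit.
Unset Printing Implicit Defensive.

Import Order.TTheory GRing.Theory Num.Theory.
Local Open Scope ring_scope.

(** * Rearrangement and layer-cake inequalities *)

Section LayerCake.
Variable R : realFieldType.

(** The integral from [a] of the indicator of [t < v], as a finite sum over the gaps of the grid
    [a :: g]; for [v] on an increasing grid it is [v - a]. *)
Fixpoint layers (a : R) (g : seq R) (v : R) : R :=
  if g is b :: g' then (b - a) * (a < v)%R%:R + layers b g' v else 0.

Lemma layers_le a g v : path <=%R a g -> v <= a -> layers a g v = 0.
Proof.
elim: g a => //= b g IHg a /andP[ab pg] va.
by rewrite ltNge va mulr0 add0r IHg // (le_trans va).
Qed.

Lemma layersE a g v : path <=%R a g -> v \in a :: g -> layers a g v = v - a.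
Proof.
elim: g a => [|b g IHg] a /=.
  by rewrite inE => _ /eqP ->; rewrite subrr.
move=> /andP[ab pg]; rewrite inE => /predU1P[->|vg].
  by rewrite ltxx mulr0 add0r layers_le // subrr.
rewrite IHg //; have bv : b <= v.
  move: vg; rewrite inE => /predU1P[->//|].
  by move: pg; rewrite (path_sortedE le_trans) => /andP[/allP + _] => /[apply].
case: ltP => [av|va]; first by rewrite mulr1; lra.
by rewrite mulr0; lra.
Qed.

(** Both sums are integrals over [t] of the weight of the indices whose value exceeds [t], so the
    hypothesis at each [t] integrates. A grid through all values of [x] and [y] makes the integrals
    finite sums, compared gap by gap. *)
Lemma layer_cake_le (J : finType) (w x y : J -> R) (c : R) :
    (forall k, 0 <= x k) -> (forall k, 0 <= y k) ->
    (forall t, 0 <= t ->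
       \sum_(k | t < x k) w k <= c * \sum_(k | t < y k) w k) ->
  \sum_k w k * x k <= c * \sum_k w k * y k.
Proof.
move=> x0 y0 xy; pose vals := codom x ++ codom y; pose g := sort <=%R vals.
have pg : path <=%R 0 g.
  rewrite (path_sortedE le_trans) sort_sorted ?andbT; last exact: le_total.
  apply/allP => z; rewrite mem_sort mem_cat.
  by case/orP => /codomP[k ->].
have lx k : x k = layers 0 g (x k).
  by rewrite layersE ?subr0 // inE mem_sort mem_cat codom_f orbT.
have ly k : y k = layers 0 g (y k).
  by rewrite layersE ?subr0 // inE mem_sort mem_cat codom_f !orbT.
rewrite (eq_bigr _ (fun k _ => congr1 ( *%R (w k)) (lx k))).
rewrite [X in c * X](eq_bigr _ (fun k _ => congr1 ( *%R (w k)) (ly k))).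
suff layers_sum a : path <=%R a g -> 0 <= a ->
    \sum_k w k * layers a g (x k) <= c * \sum_k w k * layers a g (y k).
  exact: layers_sum.
elim: {pg lx ly} g a => [|b g IHg] a /=.
  by move=> _ _; rewrite !big1 ?mulr0 // => k _; rewrite mulr0.
move=> /andP[ab pg] a0; have {}IHg := IHg _ pg (le_trans a0 ab).
have split_layer (z : J -> R) : \sum_k w k * ((b - a) * (a < z k)%R%:R + layers b g (z k))
    = (b - a) * (\sum_(k | a < z k) w k) + \sum_k w k * layers b g (z k).
  rewrite mulr_sumr [in RHS]big_mkcond -big_split /=.
  by apply: eq_bigr => k _; case: ifP => _; rewrite ?mulr1 ?mulr0; lra.
rewrite !split_layer mulrDr lerD // mulrCA ler_wpM2l ?subr_ge0 //.
exact: xy.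
Qed.

End LayerCake.

Lemma sorting_perm n (le : rel 'I_n) :
    antisymmetric le -> transitive le -> total le ->
  exists s : 'S_n, forall i j, le (s i) (s j) = (i <= j)%N.
Proof.
move=> le_anti le_tr le_tot.
have le_refl : reflexive le by move=> i; case/orP: (le_tot i i).
pose t := sort le (enum 'I_n).
have size_t : size t = n by rewrite size_sort size_enum_ord.
pose f (i : 'I_n) := nth i t i.
have f_inj : injective f.
  move=> i j; rewrite /f (set_nth_default i) ?size_t // => /eqP.
  by rewrite nth_uniq ?size_t ?sort_uniq ?enum_uniq // => /eqP/val_inj.
exists (perm f_inj) => i j; rewrite !permE.
have mono (k l : 'I_n) : (k <= l)%N -> le (f k) (f l).
  move=> kl; rewrite /f (set_nth_default l k) ?size_t //.
  by apply: (sorted_leq_nth le_tr le_refl); rewrite ?inE ?size_t ?sort_sorted.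
apply/idP/idP => [ij|]; last exact: mono.
rewrite leqNgt; apply/negP => ji; have := mono _ _ (ltnW ji) => ji'.
have /f_inj eij : f i = f j by apply: le_anti; rewrite ij ji'.
by rewrite eij ltnn in ji.
Qed.

Lemma card_ord_lt n k : (k <= n)%N -> #|[pred j : 'I_n | (j < k)%N]| = k.
Proof.
by move=> kn; rewrite -sum1_card (big_ord_narrow kn) sum1_card card_ord.
Qed.

Section Rearrangement.
Variables (R : realFieldType) (n : nat) (w : 'I_n -> R).
Hypothesis w_ge0 : forall k, 0 <= w k.
Hypothesis w_noninc : forall i k : 'I_n, (i <= k)%N -> w k <= w i.

(** The number [tau] separates the weights of the first [#|X|] positions from the others. Once [tau]
    is subtracted from every weight, the initial segment contains only nonnegative terms and leaves
    out only nonpositive ones. *)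
Lemma sum_le_initial (X : {set 'I_n}) :
  \sum_(k in X) w k <= \sum_(k < n | (k < #|X|)%N) w k.
Proof.
(* The weight just after the initial segment; the default 0 occurs when [X] is everything and lies
   below all weights by [w_ge0]. *)
pose tau := if insub #|X| is Some m then w m else 0.
have below (k : 'I_n) : (k < #|X|)%N -> tau <= w k.
  by rewrite /tau; case: insubP => // m _ <- /ltnW /w_noninc.
have above (k : 'I_n) : ~~ (k < #|X|)%N -> w k <= tau.
  rewrite /tau -leqNgt; case: insubP => [m _ <- /w_noninc //|].
  by rewrite -leqNgt => nX Xk; have := leq_trans nX Xk; rewrite leqNgt ltn_ord.
have Xn : (#|X| <= n)%N by rewrite -[X in (_ <= X)%N]card_ord max_card.
have tau_sum : \sum_(k in X) tau = \sum_(k < n | (k < #|X|)%N) tau.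
  by rewrite !sumr_const; congr (_ *+ _); rewrite -[LHS](card_ord_lt Xn).
suff : \sum_(k in X) (w k - tau) <= \sum_(k < n | (k < #|X|)%N) (w k - tau).
  by rewrite !sumrB tau_sum lerD2r.
rewrite [X in _ <= X]big_mkcond [X in X <= _]big_mkcond; apply: ler_sum => k _.
case: ifP => kX; case: ifP => [/below|/negbT/above]; lra.
Qed.

(** After reindexing, job [k] is multiplied by its position in either order, and the layer cake
    applies with factor 1. Passing to complements, the jobs with position at most [t] weigh most
    when they form an initial segment. *)
Lemma rearrangement (s : 'S_n) :
  \sum_(k < n) w k * k.+1%:R <= \sum_(k < n) w (s k) * k.+1%:R.
Proof.
rewrite [X in _ <= X](reindex_inj (@perm_inj _ s^-1)) /=.
under [X in _ <= X]eq_bigr do rewrite permKV.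
rewrite -[X in _ <= X]mul1r.
apply: layer_cake_le => [k|k|t _]; rewrite ?ler0n // mul1r.
have sum_gt (z : 'I_n -> R) :
    \sum_(k | t < z k) w k = \sum_k w k - \sum_(k | z k <= t) w k.
  rewrite [X in X - _](bigID (fun k => z k <= t)) /= addrAC subrr add0r.
  by apply: eq_bigl => k; rewrite ltNge.
rewrite !sum_gt lerD2l lerN2.
pose X := [set k : 'I_n | (s^-1%g k).+1%:R <= t].
have -> : \sum_(k | (s^-1%g k).+1%:R <= t) w k = \sum_(k in X) w k.
  by apply: eq_bigl => k; rewrite inE.
apply: le_trans (sum_le_initial X) _.
rewrite [X in _ <= X]big_mkcond [X in X <= _]big_mkcond; apply: ler_sum => k _.
have [kX|//] := ifP; last by case: ifP => // _ _.
suff -> : k.+1%:R <= t by [].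
(* If [k.+1] exceeded [t], the positions [j] with [j.+1 <= t], which are as many as the elements of
   [X], would all lie below [k], so [#|X|] would be at most [k]. *)
rewrite leNgt; apply/negP => tk; move: kX; apply/negP; rewrite -leqNgt.
have -> : #|X| = #|[set j : 'I_n | j.+1%:R <= t]|.
  rewrite -[RHS](card_preimset _ (@perm_inj _ s^-1)).
  by apply: eq_card => j; rewrite !inE.
rewrite -[X in (_ <= X)%N](card_ord_lt (ltnW (ltn_ord k))).
apply: subset_leq_card; apply/subsetP => j; rewrite !inE => jt.
by have := le_lt_trans jt tk; rewrite ltr_nat ltnS.
Qed.

End Rearrangement.

(** * List schedules *)

Section ListSchedule.
Variables (R : realType) (I : instance).
Local Notation n := (njobs I).
Implicit Types (S : schedule R I) (s : 'S_n) (t : R).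

Definition supplied_before (l : 'I_(nsupplies I)) : rat :=
  \sum_(m < nsupplies I | (m < l)%N) supply_qty m.

(** A supply has to be awaited exactly when those before it fall short of [P], so the last such
    supply is the one that covers [P]. *)
Definition release (P : rat) : rat :=
  \big[Num.max/0]_(l < nsupplies I | supplied_before l < P) supply_time l.

Definition prefix_req s (k : 'I_n) : rat := \sum_(i < n | (i <= k)%N) req (s i).

(* Start time of the [k]-th job: some job [i] starts at its release time and the
   machine is busy from then on. *)
Definition list_start s (k : 'I_n) : rat :=
  \big[Num.max/0]_(i < n | (i <= k)%N) (release (prefix_req s i) + (k - i)%:R).

Lemma release_ge0 P : 0 <= release P.
Proof. exact: bigmax_ge_id. Qed.

Lemma ratr_bigmax (J : finType) (Q : pred J) (F : J -> rat) :
  ratr (\big[Num.max/0]_(j | Q j) F j) =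
  \big[Num.max/0]_(j | Q j) (ratr (F j) : R).
Proof. exact: (big_morph _ (maxr_rat R) (rmorph0 _)). Qed.

Lemma supply_time_mono (l m : 'I_(nsupplies I)) :
  (l <= m)%N -> supply_time l <= supply_time m.
Proof.
rewrite leq_eqVlt => /predU1P[/val_inj -> //|/supply_time_incr/ltW //].
Qed.

(** The bound on [P] matters: a demand above the total supply is never met, whereas [release] is
    always a finite time. *)
Lemma releaseP (P : rat) (t : R) : 0 <= t -> P <= \sum_(j < n) req j ->
  (ratr P <= supplied I t) = (ratr (release P) <= t).
Proof.
move=> t0 Ptot; rewrite /release ratr_bigmax.
have supplied_le (l : 'I_(nsupplies I)) : t < ratr (supply_time l) ->
    supplied I t <= ratr (supplied_before l).
  move=> tl; rewrite /supplied /supplied_before rmorph_sum /=.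
  rewrite [X in _ <= X]big_mkcond [X in X <= _]big_mkcond; apply: ler_sum => m _.
  case: ifP => [mt|_]; last by case: ifP; rewrite // ler0q ltW ?supply_qty_gt0.
  case: (leqP l m) => // lm; have := le_lt_trans mt tl.
  by rewrite ltr_rat ltNge supply_time_mono.
apply/idP/bigmax_leP => [Pt|[_ rel]].
  split=> // l lP; rewrite leNgt; apply/negP => /supplied_le.
  by move=> /(le_trans Pt); rewrite ler_rat leNgt lP.
rewrite leNgt; apply/negP => tP.
(* Otherwise everything has arrived by [t], and total supply equals total requirement. *)
have [l tl] : exists l : 'I_(nsupplies I), t < ratr (supply_time l).
  apply/existsP; rewrite -[X in is_true X]negbK negb_exists; apply/negP => /forallP early.
  move: tP; apply/negP; rewrite -leNgt (le_trans (_ : _ <= ratr (\sum_(j < n) req j))) ?ler_rat //.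
  rewrite req_eq_supply rmorph_sum /= /supplied.
  rewrite [X in _ <= X](eq_bigl xpredT) // => l; apply/idP.
  by rewrite leNgt.
(* What precedes the first supply after [t] is exactly what has arrived by [t]. This is less than
   [P], so that supply counts in [release]. *)
case: (@arg_minnP _ l (fun l => t < ratr (supply_time l)) val tl) => {tl}l tl lmin.
suff: supplied_before l < P by move/rel; rewrite leNgt tl.
rewrite -(ltr_rat R) (le_lt_trans _ tP) // /supplied_before /supplied rmorph_sum /=.
rewrite le_eqVlt; apply/orP; left; apply/eqP/eq_bigl => m.
apply/idP/idP => [|mt]; first by apply: contraTT; rewrite -ltNge -leqNgt => /lmin.
rewrite ltnNge; apply/negP => /supply_time_mono; rewrite -(ler_rat R) leNgt.
by rewrite (le_lt_trans mt).
Qed.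

Lemma prefix_req_le s k : prefix_req s k <= \sum_(j < n) req j.
Proof.
rewrite (reindex_inj (@perm_inj _ s)) /prefix_req /= [X in X <= _]big_mkcond.
by apply: ler_sum => i _; case: ifP => // _; apply: req_ge0.
Qed.

Lemma prefix_req_mono s (i k : 'I_n) :
  (i <= k)%N -> prefix_req s i <= prefix_req s k.
Proof.
move=> ik; rewrite /prefix_req [X in _ <= X]big_mkcond [X in X <= _]big_mkcond.
apply: ler_sum => j _; case: ifP => [ji|_]; first by rewrite (leq_trans ji).
by case: ifP => // _; apply: req_ge0.
Qed.

Lemma release_mono P P' : P <= P' -> release P <= release P'.
Proof.
move=> PP'; apply/bigmax_leP; split=> [|l lP]; first exact: release_ge0.
by rewrite /release (bigmaxD1 l) ?le_max ?lexx // (lt_le_trans lP).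
Qed.

Lemma list_start_leP s (k : 'I_n) t :
  reflect (0 <= t /\ forall i : 'I_n, (i <= k)%N ->
             ratr (release (prefix_req s i)) + (k - i)%:R <= t)
          (ratr (list_start s k) <= t).
Proof.
rewrite /list_start ratr_bigmax; apply: (iffP (bigmax_leP _ _ _ _)) => -[t0 H].
  by split=> // i /H; rewrite rmorphD /= ratr_nat.
by split=> // i /H; rewrite rmorphD /= ratr_nat.
Qed.

Lemma list_start_ge0 s k : 0 <= list_start s k.
Proof. exact: bigmax_ge_id. Qed.

Hypothesis unit_proc : forall j : 'I_n, proc j = 1.

Lemma completionE S j : completion S j = S j + 1.
Proof. by rewrite /completion unit_proc rmorph1. Qed.

(** Every term of the maximum for [i] reappears in the maximum for [k], increased by [k - i]. *)
Lemma list_start_gap s (i k : 'I_n) : (i < k)%N ->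
  ratr (list_start s i) + 1 <= ratr (list_start s k) :> R.
Proof.
move=> ik; rewrite -lerBrDr; apply/list_start_leP.
have /list_start_leP[_ H] := lexx (ratr (list_start s k) : R).
(* The default 0 of the maximum is covered by the term of [i] itself, whose release time is
   nonnegative. *)
split=> [|j ji].
  have := H i (ltnW ik); have : 0 <= ratr (release (prefix_req s i)) :> R.
    by rewrite ler0q release_ge0.
  have : 1 <= (k - i)%:R :> R by rewrite ler1n subn_gt0.
  lra.
have := H j (leq_trans ji (ltnW ik)).
have -> : (k - j = (i - j) + (k - i))%N by lia.
rewrite natrD; have : 1 <= (k - i)%:R :> R by rewrite ler1n subn_gt0.
lra.
Qed.

(** The closed form solves the recursion of list scheduling: the maximum of the own release time and
    the start of the predecessor plus one. Hence the admissible times form a half-line. *)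
Lemma may_startE s S (k : 'I_n) t :
    (forall i : 'I_n, i.+1 = k :> nat -> S (s i) = ratr (list_start s i)) ->
  may_start s S k t <-> ratr (list_start s k) <= t.
Proof.
move=> Sprev; rewrite /may_start.
have -> : \sum_(i < n | (i <= k)%N) ratr (req (s i)) = ratr (prefix_req s k) :> R.
  by rewrite /prefix_req rmorph_sum.
split=> [[t0 prev]|kt].
  rewrite releaseP ?prefix_req_le // => rel; apply/list_start_leP; split=> // i.
  rewrite leq_eqVlt => /predU1P[/val_inj ->|ik]; first by rewrite subnn addr0.
  have k1n : (k.-1 < n)%N by apply: leq_ltn_trans (leq_pred k) _.
  have k1k : (Ordinal k1n).+1 = k by rewrite /= prednK // (leq_ltn_trans _ ik).
  have := prev _ k1k; rewrite completionE Sprev // -lerBrDr => /list_start_leP[_ /(_ i)].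
  rewrite -ltnS k1k => /(_ ik); rewrite /= -lerBrDr.
  have -> : (k - i = (k.-1 - i) + 1)%N by move: ik => /=; lia.
  by rewrite natrD; lra.
have /list_start_leP[t0 H] := kt; split=> // [i ik|].
  rewrite completionE Sprev //; apply: le_trans kt.
  by apply: list_start_gap; rewrite ik.
rewrite releaseP ?prefix_req_le //.
by have := H k (leqnn k); rewrite subnn addr0.
Qed.

(** By induction on positions, the least admissible start is forced. An order thus has a unique list
    schedule, and the closed form replaces minimality from here on. *)
Lemma is_list_scheduleP s S :
  is_list_schedule s S <-> forall k, S (s k) = ratr (list_start s k).
Proof.
split=> [lS k|H k]; last first.
  have Sprev (i : 'I_n) : i.+1 = k :> nat -> S (s i) = ratr (list_start s i) by [].
  by split=> [|t]; rewrite may_startE // H.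
have [m] := ubnP (val k); elim: m k => // m IHm k; rewrite ltnS => km.
have Sprev (i : 'I_n) : i.+1 = k :> nat -> S (s i) = ratr (list_start s i).
  by move=> ik; apply: IHm; rewrite ik.
have [/may_startE kS min] := lS k; apply/le_anti; rewrite kS // andbT.
by apply: min; apply/may_startE.
Qed.

Definition list_schedule s : schedule R I := fun j => ratr (list_start s (s^-1%g j)).

Lemma list_schedule_spec s : is_list_schedule s (list_schedule s).
Proof. by apply/is_list_scheduleP => k; rewrite /list_schedule permK. Qed.

Lemma supplied_ge0 t : 0 <= supplied I t.
Proof. by apply: sumr_ge0 => l _; rewrite ler0q ltW ?supply_qty_gt0. Qed.

Lemma list_schedule_feasible s S : is_list_schedule s S -> feasible S.
Proof.
move=> /is_list_scheduleP H.
have HV j : S j = ratr (list_start s (s^-1%g j)) by rewrite -H permKV.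
split=> [j|t i j|t t0].
- by rewrite HV ler0q list_start_ge0.
- have gap i' j' : (s^-1%g i' < s^-1%g j')%N -> S i' + 1 <= S j'.
    by rewrite !HV; apply: list_start_gap.
  rewrite !completionE => /andP[it ti] /andP[jt tj].
  apply: (@perm_inj _ s^-1%g); apply/val_inj.
  have [ij|ij|//] := ltngtP (s^-1%g i) (s^-1%g j).
    by have ? := gap _ _ ij; exfalso; lra.
  by have ? := gap _ _ ij; exfalso; lra.
have [k kt|none] := pickP (fun k : 'I_n => S (s k) <= t); last first.
  rewrite big1 ?supplied_ge0 // => j; have := none (s^-1%g j).
  by rewrite permKV => ->.
(* If [k] is the last position started by [t], the jobs started by [t] are exactly the positions up
   to [k], so their demand is a prefix requirement. *)
case: (@arg_maxnP _ k (fun k => S (s k) <= t) val kt) => {kt}k kt kmax.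
have -> : \sum_(j | S j <= t) ratr (req j) = ratr (prefix_req s k) :> R.
  rewrite (reindex_inj (@perm_inj _ s)) /prefix_req rmorph_sum /=.
  apply: eq_bigl => i; apply/idP/idP => [/kmax //|].
  rewrite leq_eqVlt => /predU1P[/val_inj -> //|/(list_start_gap s)].
  by rewrite -!H; move: kt; set a := S _; set b := S _; lra.
rewrite releaseP ?prefix_req_le //.
have := lexx (ratr (list_start s k) : R); move/list_start_leP => [_ /(_ k (leqnn k))].
by rewrite subnn addr0 => /le_trans; apply; rewrite -H.
Qed.

(** * Domination by list schedules and existence of an optimum *)

Lemma list_schedule_dominates S : feasible S ->
  exists s, forall k, ratr (list_start s k) <= S (s k).
Proof.
move=> [S0 disj res].
(* Jobs have positive length, so distinct jobs start at distinct times; comparing starts is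
   therefore antisymmetric and the jobs can be sorted by start. *)
have S_inj i j : S i = S j -> i = j.
  by move=> e; apply: (disj (S i)); rewrite ?completionE e lexx; lra.
have [||| s sP] := @sorting_perm n (fun i j => S i <= S j).
- by move=> i j /le_anti/S_inj.
- by move=> j i k; apply: le_trans.
- by move=> i j; apply: le_total.
exists s => k; apply/list_start_leP; split=> // i ik.
have rel : ratr (release (prefix_req s i)) <= S (s i).
  rewrite -releaseP ?prefix_req_le //; apply: le_trans (res _ (S0 (s i))).
  rewrite [X in _ <= X](reindex_inj (@perm_inj _ s)) /prefix_req rmorph_sum /=.
  by under [X in _ <= X]eq_bigl do rewrite sP.
suff: S (s i) + (k - i)%:R <= S (s k) by lra.
(* Otherwise both jobs would occupy the machine at time [S (s b)]. *)
have next (a b : 'I_n) : (a < b)%N -> S (s a) + 1 <= S (s b).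
  move=> ab; rewrite leNgt; apply/negP => ba.
  have : s a = s b.
    by apply: (disj (S (s b))); rewrite !completionE ?lexx ?sP ?(ltnW ab) ?ba //; lra.
  by move/perm_inj => e; rewrite e ltnn in ab.
elim: {k}(nat_of_ord k) {-2}k (erefl (nat_of_ord k)) ik => [|m IHm] k ek ik.
  have -> : i = k by apply/val_inj; move: ik; rewrite /= ek; lia.
  by rewrite subnn addr0.
move: ik; rewrite leq_eqVlt => /predU1P[/val_inj ->|ik]; first by rewrite subnn addr0.
have mn : (m < n)%N by rewrite (leq_trans _ (ltn_ord k)) // ek.
have im : (i <= Ordinal mn)%N by move: ik; rewrite /= ek ltnS.
have := IHm (Ordinal mn) erefl im; have := next (Ordinal mn) k; rewrite /= ek => /(_ (ltnSn m)).
by rewrite subSn // mulrS; lra.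
Qed.

Lemma cost_le S S' : (forall j, S j <= S' j) ->
  total_weighted_completion S <= total_weighted_completion S'.
Proof.
move=> H; apply: ler_sum => j _; rewrite !completionE ler_wpM2l ?ler0q ?(ltW (weight_gt0 _)) //.
by rewrite lerD2r.
Qed.

Lemma optimum_exists : exists opt : R, @is_optimum R I opt.
Proof.
pose cost s := total_weighted_completion (list_schedule s).
(* There are finitely many orders, so a cheapest list schedule exists. *)
case: (@arg_minP _ _ _ (1%g : 'S_n) xpredT cost isT) => s _ smin.
exists (cost s); split=> [|S /list_schedule_dominates[s' dom]].
  by exists (list_schedule s) => //; apply: list_schedule_feasible (list_schedule_spec s).
apply: le_trans (smin s' isT) _; apply: cost_le => j.
by rewrite /list_schedule (le_trans (dom _)) // permKV.
Qed.

(** In its own order, any feasible schedule completes its k-th job no earlier than time k; the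
    rearrangement inequality then exchanges this order for [s]. *)
Lemma completion_cost_ge s S : feasible S -> non_increasing_weight s ->
  \sum_k ratr (weight (s k)) * k.+1%:R <= total_weighted_completion S.
Proof.
move=> /list_schedule_dominates[s' dom] mono.
apply: (@le_trans _ _ (\sum_k ratr (weight (s' k)) * k.+1%:R)).
  have wmono (i k : 'I_n) : (i <= k)%N -> ratr (weight (s k)) <= ratr (weight (s i)) :> R.
    by move=> ik; rewrite ler_rat mono.
  (* The weights are listed along [s], so the order [s'] enters through the positions in [s] of its
     jobs. *)
  apply: le_trans (rearrangement _ wmono (s' * s^-1)%g) _ => [k|].
    by rewrite ler0q ltW ?weight_gt0.
  by apply: ler_sum => k _; rewrite permM permKV.
rewrite /total_weighted_completion [X in _ <= X](reindex_inj (@perm_inj _ s')) /=.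
apply: ler_sum => k _; rewrite completionE ler_wpM2l ?ler0q ?(ltW (weight_gt0 _)) //.
have := dom k; move/list_start_leP => [_ H].
(* The term of the very first position already bounds the start below by [k]. *)
have := H (Ordinal (leq_ltn_trans (leq0n k) (ltn_ord k))) (leq0n k).
rewrite /= subn0 => /(le_trans _) H'; rewrite mulrS addrC lerD2r.
by apply: H'; rewrite ler_wpDl // ler0q release_ge0.
Qed.

(** * The approximation factor for weights equal to requirements *)

Hypothesis weight_req : forall j : 'I_n, weight j = req j.

Lemma unreleased_weight_le s S t : feasible S -> non_increasing_weight s -> 0 <= t ->
  \sum_(k | t < ratr (release (prefix_req s k))) (ratr (weight (s k)) : R) <=
  2 * \sum_(k | t < S (s k)) ratr (weight (s k)).
Proof.
move=> [S0 _ res] mono t0.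
pose late k := t < ratr (release (prefix_req s k)) :> R.
have [k kt|none] := pickP late; last first.
  rewrite big_pred0 // mulr_ge0 // sumr_ge0 // => k _.
  by rewrite ler0q ltW ?weight_gt0.
case: (@arg_minnP _ k late val kt) => {kt}k kt kmin.
set U := \sum_(k | t < S (s k)) _.
have w0 j : 0 <= ratr (weight (s j)) :> R by rewrite ler0q ltW ?weight_gt0.
have k_unsupplied : supplied I t < ratr (prefix_req s k).
  by rewrite ltNge releaseP ?prefix_req_le // -ltNge.
have started_le : \sum_(i | S (s i) <= t) ratr (weight (s i)) < ratr (prefix_req s k) :> R.
  apply: le_lt_trans k_unsupplied; apply: le_trans (res _ t0).
  rewrite [X in _ <= X](reindex_inj (@perm_inj _ s)) /=.
  by under eq_bigr do rewrite weight_req.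
have prefE : ratr (prefix_req s k) = \sum_(i < n | (i <= k)%N) ratr (weight (s i)) :> R.
  by rewrite rmorph_sum; under [RHS]eq_bigr do rewrite weight_req.
have later_le : \sum_(i < n | (k < i)%N) ratr (weight (s i)) <= U.
  have E1 : \sum_i ratr (weight (s i)) = \sum_(i | S (s i) <= t) ratr (weight (s i)) + U :> R.
    by rewrite (bigID (fun i => S (s i) <= t)) /=; under [X in _ + X]eq_bigl do rewrite -ltNge.
  have E2 : \sum_i ratr (weight (s i)) =
      ratr (prefix_req s k) + \sum_(i < n | (k < i)%N) ratr (weight (s i)) :> R.
    rewrite (bigID (fun i : 'I_n => (i <= k)%N)) /= prefE.
    by under [X in _ + X]eq_bigl do rewrite -ltnNge.
  lra.
(* Some position up to [k] is unstarted at [t], as otherwise the started jobs would weigh at least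
   the whole prefix; its job is at least as heavy as that of [k]. *)
have wk_le : ratr (weight (s k)) <= U.
  have [i /andP[ik it]|none] := pickP (fun i : 'I_n => (i <= k)%N && (t < S (s i))).
    rewrite /U (bigD1 i) //= ler_wpDr ?sumr_ge0 //.
    by rewrite ler_rat mono.
  move: started_le; rewrite prefE ltNge => /negP[].
  rewrite [X in _ <= X]big_mkcond [X in X <= _]big_mkcond; apply: ler_sum => i _.
  by case: ifP => ik; have := none i; rewrite ik /= ?ltNge; case: ifP.
(* Release times are nondecreasing along the order, so the late positions are [k] and all its
   successors; each of the two parts is at most [U], whence the factor 2. *)
have -> : \sum_(i | late i) ratr (weight (s i)) =
    ratr (weight (s k)) + \sum_(i < n | (k < i)%N) ratr (weight (s i)) :> R.
  rewrite (bigD1 k) //=; congr (_ + _); apply: eq_bigl => i.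
  rewrite ltn_neqAle eq_sym; apply/andP/andP => -[H1 H2]; split=> //.
  - exact: kmin.
  - by apply: lt_le_trans kt _; rewrite ler_rat release_mono ?prefix_req_mono ?(ltnW H2) ?(ltnW H1).
lra.
Qed.

Lemma list_schedule_3approx s S : non_increasing_weight s -> is_list_schedule s S ->
  feasible_within_factor 3 S.
Proof.
move=> mono lS; split; first exact: list_schedule_feasible lS.
have [opt opt_opt] := optimum_exists; exists opt => //.
have [[S' S'f <-] _] := opt_opt.
have bound : \sum_k ratr (weight (s k)) * ratr (release (prefix_req s k)) <=
    2 * \sum_k ratr (weight (s k)) * S' (s k).
  have [S'0 _ _] := S'f.
  apply: layer_cake_le => [k|k|t t0]; rewrite ?ler0q ?release_ge0 //.
  exact: unreleased_weight_le.
have rank := completion_cost_ge S'f mono.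
have start_le : 
   \sum_k ratr (weight (s k)) * S' (s k) <= total_weighted_completion S'.
  rewrite /total_weighted_completion [X in _ <= X](reindex_inj (@perm_inj _ s)) /=.
  apply: ler_sum => k _; rewrite ler_wpM2l ?ler0q ?(ltW (weight_gt0 _)) //.
  by rewrite completionE; lra.
(* The release part costs twice the optimum and the rank part once, which gives the factor 3. *)
suff : total_weighted_completion S <=
  \sum_k ratr (weight (s k)) * ratr (release (prefix_req s k))
   + \sum_k ratr (weight (s k)) * k.+1%:R by lra.
rewrite /total_weighted_completion (reindex_inj (@perm_inj _ s)) -big_split /=.
apply: ler_sum => k _; rewrite -mulrDr ler_wpM2l ?ler0q ?(ltW (weight_gt0 _)) //.
rewrite completionE mulrS addrA addrAC lerD2r.
(* Each term of the maximum is at most the release time of [k] plus [k], by monotonicity of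
   [release] and [k - i <= k]. *)
move/is_list_scheduleP: lS => ->; apply/list_start_leP; split=> [|i ik].
  by rewrite addr_ge0 ?ler0n // ler0q release_ge0.
by rewrite lerD // ?ler_nat ?leq_subr // ler_rat release_mono ?prefix_req_mono.
Qed.

End ListSchedule.

(** * Sizes of values and costs of expressions *)

Arguments bits : simpl never.

Lemma bits_ge2 z : (2 <= bits z)%N.
Proof. by []. Qed.

Lemma vsize_ge2 v : (2 <= vsize v)%N.
Proof. by elim: v => //= v1 IH1 v2 IH2; lia. Qed.

Lemma bits_nat (m : nat) : (bits m%:Z <= m + 2)%N.
Proof.
rewrite /bits absz_nat addn2 !ltnS.
case: m => [|m]; first by [].
have := @trunc_logP 2 m.+1 isT isT.
by move/(leq_trans (ltnW (ltn_expl _ (isT : 1 < 2)%N))).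
Qed.

Lemma absz_lt_bits z : (`|z| < 2 ^ (bits z).-1)%N.
Proof. by rewrite /= trunc_log_ltn. Qed.

Lemma bits_lt z b : (0 < b)%N -> (`|z| < 2 ^ b)%N -> (bits z <= b.+1)%N.
Proof.
move=> b0 zb; rewrite /bits ltnS; have [->|z0] := posnP `|z|%N; first by [].
rewrite -(ltn_exp2l _ _ (isT : 1 < 2)%N); apply: leq_ltn_trans zb.
exact: trunc_logP.
Qed.

(** A sum is at most one bit longer than its longer operand. The coarser bound has the same form as
    for products, so [vsize_eval] treats all arithmetic operations alike. *)
Lemma bits_add x y : (bits (x + y) <= bits x + bits y)%N.
Proof.
have hx := absz_lt_bits x; have hy := absz_lt_bits y.
have [p Ep] : exists p, bits x = p.+2 by exists (bits x).-2.
have [q Eq] : exists q, bits y = q.+2 by exists (bits y).-2.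
rewrite Ep Eq /= in hx hy *.
apply: leq_trans (bits_lt (b := (maxn p q).+2) isT _) _; last by lia.
rewrite expnS mul2n -addnn; apply: (@leq_ltn_trans (`|x| + `|y|)); first by lia.
have : (2 ^ p.+1 <= 2 ^ (maxn p q).+1)%N by rewrite leq_exp2l //; lia.
have : (2 ^ q.+1 <= 2 ^ (maxn p q).+1)%N by rewrite leq_exp2l //; lia.
lia.
Qed.

Lemma bits_opp x : bits (- x) = bits x.
Proof. by rewrite /bits abszN. Qed.

Lemma bits_mul x y : (bits (x * y) <= bits x + bits y)%N.
Proof.
have hx := absz_lt_bits x; have hy := absz_lt_bits y.
have [p Ep] : exists p, bits x = p.+2 by exists (bits x).-2.
have [q Eq] : exists q, bits y = q.+2 by exists (bits y).-2.
rewrite Ep Eq /= in hx hy *.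
apply: leq_trans (bits_lt (b := p.+1 + q.+1) isT _) _; last by lia.
by rewrite abszM expnD ltn_mul.
Qed.

Lemma vsize_vint v : (bits (vint v) <= vsize v)%N.
Proof.
case: v => // v1 v2; apply: leq_trans (vsize_ge2 _).
by rewrite [vint _]/=.
Qed.

Lemma vsize_vfst v : (vsize (vfst v) <= vsize v)%N.
Proof. by case: v => //= v1 v2; apply: ltnW; rewrite ltnS ?leq_addr ?leq_addl. Qed.

Lemma vsize_vsnd v : (vsize (vsnd v) <= vsize v)%N.
Proof. by case: v => //= v1 v2; apply: ltnW; rewrite ltnS ?leq_addr ?leq_addl. Qed.

Lemma vsize_vbool b : vsize (vbool b) = 2.
Proof. by case: b. Qed.

Definition bounded (M : nat) (st : store) : Prop := forall y, (vsize (st y) <= M)%N.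

Lemma bounded_update M st x v :
  bounded M st -> (vsize v <= M)%N -> bounded M (update st x v).
Proof. by move=> bst vM y; rewrite /update; case: ifP. Qed.

(** Even multiplication only adds sizes, so a fixed expression yields values of size linear in a
    bound on the store; this is the slope. *)
Fixpoint size_factor (e : expr) : nat :=
  match e with
  | Var _ => 1
  | Const z => bits z
  | Fst e1 | Snd e1 | IsPair e1 => size_factor e1
  | Cons e1 e2 | Add e1 e2 | Sub e1 e2 | Mul e1 e2 | Le e1 e2 =>
      (size_factor e1 + size_factor e2).+1
  end.

Fixpoint cost_factor (e : expr) : nat :=
  (size_factor e +
   match e with
   | Var _ | Const _ => 0
   | Fst e1 | Snd e1 | IsPair e1 => cost_factor e1
   | Cons e1 e2 | Add e1 e2 | Sub e1 e2 | Mul e1 e2 | Le e1 e2 =>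
       cost_factor e1 + cost_factor e2
   end)%N.

Lemma vsize_eval M st e : bounded M st -> (vsize (eval st e) <= size_factor e * M)%N.
Proof.
move=> bst; have M2 : (2 <= M)%N by apply: leq_trans (bst 0%N); apply: vsize_ge2.
have arith f e1 e2 : (forall x y, bits (f x y) <= bits x + bits y)%N ->
    (vsize (eval st e1) <= size_factor e1 * M)%N ->
    (vsize (eval st e2) <= size_factor e2 * M)%N ->
    (bits (f (vint (eval st e1)) (vint (eval st e2)))
       <= (size_factor e1 + size_factor e2).+1 * M)%N.
  move=> hf IH1 IH2; have := hf (vint (eval st e1)) (vint (eval st e2)).
  have := vsize_vint (eval st e1); have := vsize_vint (eval st e2).
  by rewrite mulSn mulnDl; lia.
elim: e => [x|z|e1 IH1 e2 IH2|e1 IH1|e1 IH1|e1 IH1|e1 IH1 e2 IH2|e1 IH1 e2 IH2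
           |e1 IH1 e2 IH2|e1 IH1 e2 IH2].
- by rewrite /= mul1n.
- by rewrite /=; apply: leq_pmulr; lia.
- by rewrite /= mulSn mulnDl; lia.
- exact: leq_trans (vsize_vfst _) IH1.
- exact: leq_trans (vsize_vsnd _) IH1.
- by apply: leq_trans IH1; rewrite [eval _ _]/= vsize_vbool vsize_ge2.
- exact: (arith _ _ _ bits_add).
- by apply: (arith (fun x y => x - y)) => // x y; rewrite -(bits_opp y) bits_add.
- exact: (arith _ _ _ bits_mul).
- by rewrite [eval _ _]/= vsize_vbool /= mulSn; lia.
Qed.

Lemma cost_le_factor M st e : bounded M st -> (cost st e <= cost_factor e * M)%N.
Proof.
move=> bst; have H e' := vsize_eval e' bst.
elim: e => [x|z|e1 IH1 e2 IH2|e1 IH1|e1 IH1|e1 IH1|e1 IH1 e2 IH2|e1 IH1 e2 IH2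
           |e1 IH1 e2 IH2|e1 IH1 e2 IH2]; rewrite /cost -/cost /cost_factor -/cost_factor
  !mulnDl ?mul0n; apply: leq_add => //; exact: leq_add.
Qed.

(** * While programs with loops over lists only *)

Inductive scmd :=
  | SAssign of nat & expr
  | SSeq of scmd & scmd
  | SIf of expr & scmd & scmd
  | SFor of nat & nat & expr & scmd.

(* [SFor x l e c] keeps the rest of the list in the variable [l]. *)
Fixpoint compile (c : scmd) : cmd :=
  match c with
  | SAssign x e => Assign x e
  | SSeq c1 c2 => Seq (compile c1) (compile c2)
  | SIf e c1 c2 => If e (compile c1) (compile c2)
  | SFor x l e c1 =>
      Seq (Assign l e)
          (While (IsPair (Var l))
             (Seq (Assign x (Fst (Var l)))
                  (Seq (Assign l (Snd (Var l))) (compile c1))))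
  end.

Fixpoint writes (c : scmd) : seq nat :=
  match c with
  | SAssign x _ => [:: x]
  | SSeq c1 c2 | SIf _ c1 c2 => writes c1 ++ writes c2
  | SFor x l _ c1 => [:: x, l & writes c1]
  end.

(** Neither the current item nor the body may overwrite the rest of the list, so a loop runs exactly
    once per item. *)
Fixpoint wf (c : scmd) : bool :=
  match c with
  | SAssign _ _ => true
  | SSeq c1 c2 | SIf _ c1 c2 => wf c1 && wf c2
  | SFor x l _ c1 => [&& x != l, l \notin writes c1 & wf c1]
  end.

Definition next_item (x l : nat) (h t : value) (st : store) : store :=
  update (update st x h) l t.

Section Loop.
Variables (body : store -> store) (body_safe : store -> Prop) (x l : nat).

Fixpoint loop (v : value) (st : store) : store :=
  if v is Pair h t then loop t (body (next_item x l h t st)) else st.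

Fixpoint loop_safe (v : value) (st : store) : Prop :=
  if v is Pair h t then
    body_safe (next_item x l h t st) /\
    loop_safe t (body (next_item x l h t st))
  else True.

End Loop.

(** Since loops only traverse lists, execution is a total function, and correctness can be separated
    from running time. *)
Fixpoint run (c : scmd) (st : store) : store :=
  match c with
  | SAssign x e => update st x (eval st e)
  | SSeq c1 c2 => run c2 (run c1 st)
  | SIf e c1 c2 => if truthy (eval st e) then run c1 st else run c2 st
  | SFor x l e c1 => loop (run c1) x l (eval st e) (update st l (eval st e))
  end.

(** [safe M c st]: no assignment in the run of [c] from [st] stores a value of
    more than [M] bits. *)
Fixpoint safe (M : nat) (c : scmd) (st : store) : Prop :=
  match c with
  | SAssign x e => (vsize (eval st e) <= M)%N
  | SSeq c1 c2 => safe M c1 st /\ safe M c2 (run c1 st)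
  | SIf e c1 c2 => if truthy (eval st e) then safe M c1 st else safe M c2 st
  | SFor x l e c1 =>
      (vsize (eval st e) <= M)%N /\
      loop_safe (run c1) (safe M c1) x l (eval st e) (update st l (eval st e))
  end.

Lemma run_frame c st y : y \notin writes c -> run c st y = st y.
Proof.
elim: c st => [x e|c1 IH1 c2 IH2|e c1 IH1 c2 IH2|x l e c1 IH1] st.
- by rewrite inE /= /update => /negPf ->.
- by rewrite /= mem_cat negb_or => /andP[y1 y2]; rewrite IH2 ?IH1.
- by rewrite /= mem_cat negb_or => /andP[y1 y2]; case: ifP => _; rewrite ?IH2 ?IH1.
rewrite /= !inE !negb_or => /and3P[yx yl y1].
have upd v st1 : update st1 l v y = st1 y by rewrite /update (negPf yl).
rewrite -[RHS](upd (eval st e)); move: (eval st e) => v.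
elim: v (update st l v) => //= h _ t IHt st1.
by rewrite IHt IH1 // /next_item upd /update (negPf yx).
Qed.

Lemma run_bounded M c st : bounded M st -> safe M c st -> bounded M (run c st).
Proof.
elim: c st => [x e|c1 IH1 c2 IH2|e c1 IH1 c2 IH2|x l e c1 IH1] st bst /=.
- by move=> ve; apply: bounded_update.
- by move=> [s1 s2]; apply: IH2 => //; apply: IH1.
- by case: ifP => _ sc; [apply: IH1 | apply: IH2].
move=> [ve ls]; have {bst} : bounded M (update st l (eval st e)) by exact: bounded_update.
move: ve ls; elim: (eval st e) (update st l _) => //= h _ t IHt st1 ve [sc ls] bst.
have hM : (vsize h <= M)%N by lia.
have tM : (vsize t <= M)%N by lia.
by apply: IHt => //; apply: IH1 => //; do 2!apply: bounded_update => //.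
Qed.

(** [M] bounds the size of every stored value, and hence also the number of iterations of any loop;
    each level of nesting multiplies by [M]. *)
Fixpoint time_bound (c : scmd) (M : {poly nat}) : {poly nat} :=
  match c with
  | SAssign x e => M *+ cost_factor e
  | SSeq c1 c2 => time_bound c1 M + time_bound c2 M
  | SIf e c1 c2 => M *+ cost_factor e + (time_bound c1 M + time_bound c2 M)
  | SFor x l e c1 =>
      M *+ cost_factor e +
      (M * (M *+ (cost_factor (IsPair (Var l)) + cost_factor (Fst (Var l))
                  + cost_factor (Snd (Var l)))%N + time_bound c1 M)
       + M *+ cost_factor (IsPair (Var l)))
  end.

Lemma horner_natD (p q : {poly nat}) (N : nat) : (p + q).[N] = (p.[N] + q.[N])%N.
Proof. exact: hornerD. Qed.

Lemma horner_natM (p q : {poly nat}) (N : nat) : (p * q).[N] = (p.[N] * q.[N])%N.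
Proof. exact: hornerM. Qed.

Lemma horner_natMn (p : {poly nat}) (m N : nat) : (p *+ m).[N] = (m * p.[N])%N.
Proof.
by elim: m => [|m IHm]; rewrite ?mulr0n ?horner0 // mulrS horner_natD IHm mulSn.
Qed.

Definition horner_nat := (horner_natD, horner_natM, horner_natMn).

(* The number of iterations of a loop is bounded by the size of the list, so the
   bound on sizes alone yields a bound on time. *)
Lemma exec_compile (p : {poly nat}) (N : nat) c st :
    wf c -> bounded p.[N] st -> safe p.[N] c st ->
  exists2 t, exec (compile c) st (run c st) t & (t <= (time_bound c p).[N])%N.
Proof.
set M := p.[N].
elim: c st => [x e|c1 IH1 c2 IH2|e c1 IH1 c2 IH2|x l e c1 IH1] st /=.
- move=> _ bst ve.
  exists (cost st e); first exact: exec_assign.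
  by rewrite !horner_nat; apply: cost_le_factor.
- move=> /andP[w1 w2] bst [s1 s2].
  have [t1 e1 T1] := IH1 _ w1 bst s1.
  have [t2 e2 T2] := IH2 _ w2 (run_bounded bst s1) s2.
  exists (t1 + t2)%N; first exact: exec_seq e1 e2.
  by rewrite !horner_nat leq_add.
- move=> /andP[w1 w2] bst; have ce := cost_le_factor e bst.
  case: ifP => he sc.
    have [t1 e1 T1] := IH1 _ w1 bst sc; exists (cost st e + t1)%N.
      by apply: exec_if; rewrite he.
    by rewrite !horner_nat -/M; lia.
  have [t2 e2 T2] := IH2 _ w2 bst sc; exists (cost st e + t2)%N.
    by apply: exec_if; rewrite he.
  by rewrite !horner_nat -/M; lia.
move=> /and3P[xl l1 w1] bst [ve ls]; have ce := cost_le_factor e bst.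
rewrite !horner_nat -/M.
(* [A] pays for one iteration: the test, two assignments and the body. [cc] is the unfolded cost
   factor of the test, and [cc * M] pays for its final failure. *)
set cc := (1 + (1 + 0))%N; set A := (_ * M + (time_bound c1 p).[N])%N.
suff loop_exec v st1 : st1 l = v -> bounded M st1 ->
    loop_safe (run c1) (safe M c1) x l v st1 ->
  exists2 t, exec (While (IsPair (Var l)) (Seq (Assign x (Fst (Var l)))
                (Seq (Assign l (Snd (Var l))) (compile c1)))) st1
               (loop (run c1) x l v st1) t
           & (t <= vsize v * A + cc * M)%N.
  have [||t1 e1 T1] := loop_exec _ _ _ _ ls.
  - by rewrite /update eqxx.
  - exact: bounded_update.
  exists (cost st e + t1)%N; first exact: exec_seq (exec_assign _ _ _) e1.
  apply: leq_add => //; apply: leq_trans T1 _; rewrite leq_add2r.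
  by rewrite leq_mul2r ve orbT.
elim: v st1 {bst ve ls ce} => [z|h _ t IHt] st1 el bst1 /=.
  move=> _; exists (cost st1 (IsPair (Var l))).
    by apply: exec_while_stop; rewrite /= el.
  by apply: leq_trans (cost_le_factor _ bst1) _; rewrite leq_addl.
move=> [sc ls].
have hM : (vsize h <= M)%N by have := bst1 l; rewrite el /=; lia.
have tM : (vsize t <= M)%N by have := bst1 l; rewrite el /=; lia.
have b2 : bounded M (update st1 x h) by exact: bounded_update.
have b3 : bounded M (next_item x l h t st1) by exact: bounded_update.
have [t1 e1 T1] := IH1 _ w1 b3 sc.
have [|t2 e2 T2] := IHt _ _ (run_bounded b3 sc) ls.
  by rewrite run_frame // /next_item /update eqxx.
have c1b := cost_le_factor (IsPair (Var l)) bst1.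
have c2b := cost_le_factor (Fst (Var l)) bst1.
have c3b := cost_le_factor (Snd (Var l)) b2.
have ex : eval st1 (Fst (Var l)) = h by rewrite /= el.
have el' : eval (update st1 x h) (Snd (Var l)) = t.
  by rewrite /= /update eq_sym (negPf xl) el.
eexists; first apply: exec_while_step e2; first by rewrite /= el.
  apply: exec_seq (exec_assign _ _ _) _; rewrite ex.
  by apply: exec_seq (exec_assign _ _ _) _; rewrite el'; exact: e1.
have -> : ((vsize h + vsize t).+1 * A = vsize h * A + vsize t * A + A)%N.
  by rewrite mulSn mulnDl; lia.
have : (cost st1 (IsPair (Var l)) + (cost st1 (Fst (Var l)) +
   (cost (update st1 x h) (Snd (Var l)) + t1)) <= A)%N.
  rewrite /A; move: T1 c1b c2b c3b; rewrite /cc /=; lia.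
move: T2; lia.
Qed.

(** An invariant rule: [G] is indexed by the items already treated. The step may use that variables
    not written by the loop are as in [st], and that fetching an item changes only [x] and [l]. *)
Lemma run_for (T : Type) (enc : T -> value) M x l e c st (js : seq T)
    (G : seq T -> store -> Prop) :
    wf (SFor x l e c) -> bounded M st -> eval st e = enc_list [seq enc j | j <- js] ->
    (vsize (eval st e) <= M)%N ->
    G [::] (update st l (eval st e)) ->
    (forall pre j post st1 st2, js = pre ++ j :: post -> bounded M st2 ->
       (forall y, y \notin [:: x, l & writes c] -> st2 y = st y) ->
       (forall y, y \notin [:: x; l] -> st2 y = st1 y) -> st2 x = enc j ->
       G pre st1 -> safe M c st2 /\ G (rcons pre j) (run c st2)) ->
  safe M (SFor x l e c) st /\ G js (run (SFor x l e c) st).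
Proof.
move=> /and3P[xl l1 w1] bst ev eM G0 step.
suff H post : forall pre st1, js = pre ++ post -> bounded M st1 ->
    (vsize (enc_list [seq enc j | j <- post]) <= M)%N ->
    (forall y, y \notin [:: x, l & writes c] -> st1 y = st y) -> G pre st1 ->
  loop_safe (run c) (safe M c) x l (enc_list [seq enc j | j <- post]) st1 /\
  G js (loop (run c) x l (enc_list [seq enc j | j <- post]) st1).
  rewrite /= ev; rewrite ev in eM G0.
  have [] := H js [::] (update st l (enc_list (map enc js))) => //.
  - exact: bounded_update.
  - move=> y; rewrite !inE !negb_or => /and3P[_ yl _].
    by rewrite /update (negPf yl).
elim: post => [|j post IHpost] pre st1 ejs bst1 vM fr Gpre /=.
  by split=> //; rewrite ejs cats0.
set st2 := next_item _ _ _ _ _.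
have hM : (vsize (enc j) <= M)%N by apply: leq_trans vM; rewrite leqW ?leq_addr.
have tM : (vsize (enc_list (map enc post)) <= M)%N.
  by apply: leq_trans vM; rewrite leqW ?leq_addl.
have bst2 : bounded M st2 by do 2!apply: bounded_update => //.
have st21 y : y \notin [:: x; l] -> st2 y = st1 y.
  by rewrite !inE negb_or /st2 /next_item /update => /andP[/negPf -> /negPf ->].
have fr2 y : y \notin [:: x, l & writes c] -> st2 y = st y.
  move=> yw; rewrite st21 ?fr //; move: yw; rewrite !inE !negb_or.
  by case/and3P => -> ->.
have st2x : st2 x = enc j by rewrite /st2 /next_item /update (negPf xl) eqxx.
have [sc Gj] := step _ _ _ _ _ ejs bst2 fr2 st21 st2x Gpre.
have [|||||ls Gl] := IHpost (rcons pre j) (run c st2) => //.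
- by rewrite cat_rcons.
- exact: run_bounded.
- move=> y yw; rewrite run_frame ?fr2 //; move: yw; rewrite !inE !negb_or.
  by case/and3P.
Qed.

Lemma vsize_enc_list vs b : (forall v, v \in [seq vsize v | v <- vs] -> (v <= b)%N) ->
  (vsize (enc_list vs) <= 2 + size vs * b.+1)%N.
Proof.
elim: vs => //= v vs IHvs H; have := H (vsize v); rewrite inE eqxx => /(_ isT) vb.
have : (vsize (enc_list vs) <= 2 + size vs * b.+1)%N.
  by apply: IHvs => u us; apply: H; rewrite inE us orbT.
by rewrite /= mulSn; lia.
Qed.

Lemma size_le_vsize_list vs : (size vs <= vsize (enc_list vs))%N.
Proof. by elim: vs => //= v vs; lia. Qed.

Lemma vsize_in_list (T : eqType) (f : T -> value) (js : seq T) j :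
  j \in js -> (vsize (f j) <= vsize (enc_list [seq f j | j <- js]))%N.
Proof.
elim: js => //= i js IH; rewrite inE => /predU1P[->|/IH]; lia.
Qed.

Lemma big_rcons_com (A : Type) (op : SemiGroup.com_law A) (x : A) (T : eqType)
    (r : seq T) (a : T) (P : pred T) (F : T -> A) :
  \big[op/x]_(i <- rcons r a | P i) F i =
  if P a then op (F a) (\big[op/x]_(i <- r | P i) F i)
  else \big[op/x]_(i <- r | P i) F i.
Proof. by rewrite (perm_big (a :: r)) ?perm_rcons // big_cons. Qed.

(** * Prefixes of the enumeration of ordinals *)

Section OrdPrefix.
Variables (n : nat) (pre post : seq 'I_n) (j : 'I_n).
Hypothesis enumE : enum 'I_n = pre ++ j :: post.

Lemma ord_prefix_size : j = size pre :> nat.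
Proof.
rewrite -[LHS]index_enum_ord enumE index_cat /= eqxx addn0.
have : uniq (enum 'I_n) := enum_uniq _.
rewrite enumE cat_uniq /= negb_or => /and3P[_ /andP[jpre _] _].
by rewrite (negPf jpre).
Qed.

Lemma mem_ord_prefix i : (i \in pre) = (i < j)%N.
Proof.
rewrite -[X in (X < _)%N]index_enum_ord enumE index_cat ord_prefix_size.
by case: ifP => ipre; rewrite ?index_mem // ltnNge leq_addr.
Qed.

Lemma uniq_ord_prefix : uniq pre.
Proof. by have := enum_uniq 'I_n; rewrite enumE cat_uniq => /and3P[]. Qed.

End OrdPrefix.

(** * Arithmetic on encoded rationals *)

Definition rat_le (e f : expr) : expr := Le (Mul (Fst e) (Snd f)) (Mul (Fst f) (Snd e)).

Definition rat_add (e f : expr) : expr :=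
  Cons (Add (Mul (Fst e) (Snd f)) (Mul (Fst f) (Snd e))) (Mul (Snd e) (Snd f)).

Definition rat_zero : expr := Cons (Const 0) (Const 1).

Definition fraction (v : value) (x : rat) (b1 b2 : nat) : Prop :=
  exists a d : int, [/\ v = Pair (Int a) (Int d), 0 < d, x = a%:~R / d%:~R,
                        (bits a <= b1)%N & (bits d <= b2)%N].

Lemma fraction_enc x b : (vsize (enc_rat x) <= b)%N -> fraction (enc_rat x) x b b.
Proof.
move=> /= xb; exists (numq x), (denq x); rewrite denq_gt0 divq_num_den.
by split=> //; lia.
Qed.

Lemma eval_rat_le st e f x y b1 b2 b3 b4 :
  fraction (eval st e) x b1 b2 -> fraction (eval st f) y b3 b4 ->
  eval st (rat_le e f) = vbool (x <= y).
Proof.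
move=> [a [d [E d0 -> _ _]]] [a' [d' [E' d'0 -> _ _]]]; rewrite /rat_le /= E E' /=.
rewrite ler_pdivrMr ?ltr0z // mulrAC ler_pdivlMr ?ltr0z //.
by rewrite -!intrM ler_int.
Qed.

Lemma fraction_add st e f x y b1 b2 b3 b4 :
  fraction (eval st e) x b1 b2 -> fraction (eval st f) y b3 b4 ->
  fraction (eval st (rat_add e f)) (x + y) (b1 + b4 + (b3 + b2)) (b2 + b4).
Proof.
move=> [a [d [E d0 -> ab db]]] [a' [d' [E' d'0 -> a'b d'b]]]; rewrite /rat_add /= E E' /=.
exists (a * d' + a' * d), (d * d'); split=> //.
- exact: mulr_gt0.
- have := lt0r_neq0 d0; have := lt0r_neq0 d'0.
  rewrite -!(intr_eq0 rat) => d1 d2.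
  by rewrite rmorphD /= !intrM addf_div.
- apply: leq_trans (bits_add _ _) _; apply: leq_add;
    apply: leq_trans (bits_mul _ _) _; exact: leq_add.
- by apply: leq_trans (bits_mul _ _) _; exact: leq_add.
Qed.

(* Adding an integer keeps a fraction in lowest terms, so the program needs no
   gcd: every start time is a supply time plus an integer. *)
Lemma enc_rat_add_int (x : rat) (m : int) :
  enc_rat (x + m%:~R) = Pair (Int (numq x + m * denq x)) (Int (denq x)).
Proof.
have d0 := denq_gt0 x.
have e : x + m%:~R = (numq x + m * denq x)%:~R / (denq x)%:~R :> rat.
  rewrite rmorphD /= intrM mulrDl divq_num_den mulfK //.
  by rewrite intr_eq0 gt_eqF.
have co : coprime `|numq x + m * denq x| `|denq x|.
  have : gcdz (denq x) (m * denq x + numq x) = gcdz (denq x) (numq x) by rewrite gcdzMDl.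
  rewrite /gcdz addrC => -[]; rewrite gcdnC /coprime => ->.
  by rewrite gcdnC; apply: coprime_num_den.
rewrite /enc_rat e coprimeq_num // coprimeq_den // gt_eqF // gtr0_sg // mul1r.
by rewrite gtr0_norm.
Qed.

(** * The scheduling program *)

Section PartialSums.
Variable N : nat.

(** Cubic because each of the at most [N + 1] additions lengthens the numerator by about the length
    of the accumulated denominator, itself quadratic in [N]. The factor 10 leaves room for the other
    stored values. *)
Definition size_bound : nat := (10 * N.+1 ^ 3)%N.
Local Notation M := size_bound.

Lemma size_boundE : M = (10 * (N * N * N) + 30 * (N * N) + 30 * N + 10)%N.
Proof. by rewrite /size_bound !expnS expn0; lia. Qed.

(* Each addition of an input fraction to an accumulated one lengthens the
   denominator by at most [N] bits. *)
Definition num_bound (k : nat) : nat := (2 + k * (3 + N + N + N * N))%N.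
Definition den_bound (k : nat) : nat := (3 + k * N)%N.

Definition partial_sum (v : value) (x : rat) (k : nat) : Prop :=
  fraction v x (num_bound k) (den_bound k).

Lemma partial_sum0 st : partial_sum (eval st rat_zero) 0 0.
Proof. by exists 0, 1; split. Qed.

Lemma partial_sum_leq v x k k' : (k <= k')%N -> partial_sum v x k -> partial_sum v x k'.
Proof.
move=> kk' [a [d [-> d0 -> ab db]]]; exists a, d; split=> //.
  by apply: leq_trans ab _; rewrite /num_bound leq_add2l leq_mul2r kk' orbT.
by apply: leq_trans db _; rewrite /den_bound leq_add2l leq_mul2r kk' orbT.
Qed.

Lemma partial_sumS st e f x y k : (k <= N)%N ->
    partial_sum (eval st e) x k -> eval st f = enc_rat y -> (vsize (enc_rat y) <= N)%N ->
  partial_sum (eval st (rat_add e f)) (x + y) k.+1.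
Proof.
move=> kN hx ey /fraction_enc; rewrite -ey => hy.
have [a [d [-> d0 -> ab db]]] := fraction_add hx hy.
exists a, d; split=> //.
  apply: leq_trans ab _; rewrite /num_bound /den_bound mulSn.
  by have : (k * N <= N * N)%N; [rewrite leq_mul2r kN orbT | lia].
by apply: leq_trans db _; rewrite /den_bound mulSn; lia.
Qed.

Lemma vsize_partial_sum v x k : (k <= N.+1)%N -> partial_sum v x k -> (vsize v <= M)%N.
Proof.
move=> kN /(partial_sum_leq kN)[a [d [-> _ _ ab db]]] /=.
rewrite size_boundE; move: ab db; rewrite /num_bound /den_bound !mulSn.
by rewrite !mulnDr !mulnA; lia.
Qed.

Lemma vsize_index k : (k <= N.+1)%N -> (bits k%:Z <= M)%N.
Proof. by move=> kN; have := bits_nat k; rewrite size_boundE; lia. Qed.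

End PartialSums.

Section Program.

(* Variables: 1 and 2 hold the input lists and 3 the list of pairs (rank,
   release time) of the jobs; 4, 5 and 6, 7 hold the remaining list and the
   current item in the outer and in the inner loop, 8 and 9 the index of that
   item; 10 and 11 accumulate the requirement and the number of the jobs that
   do not come after the current one, 12 the supply, and 13 the maximum. *)
Definition not_after : expr :=
  let ai := Snd (Snd (Var 7)) in
  let aj := Snd (Snd (Var 5)) in
  Add (Sub (Const 1) (rat_le ai aj)) (Mul (rat_le aj ai) (Le (Var 9) (Var 8))).

Definition keep (x : nat) : scmd := SAssign x (Var x).

Definition rank_body : scmd :=
  SSeq (SIf not_after
          (SSeq (SAssign 10 (rat_add (Var 10) (Snd (Snd (Var 7)))))
                (SAssign 11 (Add (Var 11) (Const 1))))
          (keep 10))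
       (SAssign 9 (Add (Var 9) (Const 1))).

(* As supply times increase, the last supply reached while the supply before it
   is insufficient is the one that [release] selects. *)
Definition release_body : scmd :=
  SSeq (SIf (rat_le (Var 10) (Var 12)) (keep 13) (SAssign 13 (Fst (Var 7))))
       (SAssign 12 (rat_add (Var 12) (Snd (Var 7)))).

Definition rank_loop : scmd := SFor 7 6 (Var 1) rank_body.

Definition release_loop : scmd := SFor 7 6 (Var 2) release_body.

Definition job_body : scmd :=
  SSeq (SSeq (SAssign 10 rat_zero) (SSeq (SAssign 11 (Const 0)) (SAssign 9 (Const 0))))
 (SSeq rank_loop
 (SSeq (SSeq (SAssign 12 rat_zero) (SAssign 13 rat_zero))
 (SSeq release_loop
 (SSeq (SAssign 3 (Cons (Cons (Var 11) (Var 13)) (Var 3)))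
       (SAssign 8 (Add (Var 8) (Const 1))))))).

(** The release time of the inner job plus the difference of ranks, kept over the denominator of the
    release time and hence in lowest terms. *)
Definition candidate : expr :=
  Cons (Add (Fst (Snd (Var 7))) (Mul (Sub (Fst (Var 5)) (Fst (Var 7))) (Snd (Snd (Var 7)))))
       (Snd (Snd (Var 7))).

Definition max_body : scmd :=
  SIf (Le (Fst (Var 7)) (Fst (Var 5)))
      (SSeq (SAssign 10 candidate)
            (SIf (rat_le (Var 13) (Var 10)) (SAssign 13 (Var 10)) (keep 13)))
      (keep 13).

Definition max_loop : scmd := SFor 7 6 (Var 3) max_body.

Definition start_body : scmd :=
  SSeq (SAssign 13 rat_zero) (SSeq max_loop (SAssign 0 (Cons (Var 13) (Var 0)))).

Definition scheduler : scmd :=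
  SSeq (SSeq (SSeq (SAssign 1 (Fst (Var 0))) (SAssign 2 (Snd (Var 0))))
             (SSeq (SAssign 3 (Const 0)) (SAssign 8 (Const 0))))
 (SSeq (SFor 5 4 (Var 1) job_body)
 (SSeq (SAssign 0 (Const 0)) (SFor 5 4 (Var 3) start_body))).

Variable I : instance.
Local Notation n := (njobs I).
Definition input_size : nat := vsize (enc_instance I).
Local Notation N := input_size.
Local Notation M := (size_bound N).

Definition enc_job (j : 'I_n) : value :=
  Pair (enc_rat (proc j)) (Pair (enc_rat (weight j)) (enc_rat (req j))).

Definition enc_supply (l : 'I_(nsupplies I)) : value :=
  Pair (enc_rat (supply_time l)) (enc_rat (supply_qty l)).

(** The total order by non-increasing requirement, with ties broken by index. It is reflexive, so
    ranks count from 1 and [ready] includes the job's own requirement. *)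
Definition before (i j : 'I_n) : bool :=
  (req i <= req j) ==> ((req j <= req i) && (i <= j)%N).

Definition rank (j : 'I_n) : nat := #|[pred i | before i j]|.

Definition ready (j : 'I_n) : rat := release I (\sum_(i < n | before i j) req i).

(** The formula of [list_start] with ranks in place of positions, so that no order has to be
    constructed. *)
Definition start (j : 'I_n) : rat :=
  \big[Num.max/0]_(i < n | (rank i <= rank j)%N) (ready i + (rank j - rank i)%:R).

Definition enc_ranked (j : 'I_n) : value := Pair (Int (rank j)) (enc_rat (ready j)).

Lemma size_jobs : (n <= N)%N.
Proof.
have := size_le_vsize_list [seq enc_job j | j <- enum 'I_n].
rewrite size_map size_enum_ord => /leq_trans; apply.
by rewrite /input_size [X in (_ <= X)%N]/= leqW ?leq_addr.
Qed.

Lemma size_supplies : (nsupplies I <= N)%N.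
Proof.
have := size_le_vsize_list [seq enc_supply j | j <- enum 'I_(nsupplies I)].
rewrite size_map size_enum_ord => /leq_trans; apply.
by rewrite /input_size [X in (_ <= X)%N]/= leqW ?leq_addl.
Qed.

Lemma vsize_job j : (vsize (enc_job j) <= N)%N.
Proof.
have := vsize_in_list enc_job (mem_enum 'I_n j).
by move/leq_trans; apply; rewrite /input_size [X in (_ <= X)%N]/= leqW ?leq_addr.
Qed.

Lemma vsize_supply l : (vsize (enc_supply l) <= N)%N.
Proof.
have := vsize_in_list enc_supply (mem_enum 'I_(nsupplies I) l).
by move/leq_trans; apply; rewrite /input_size [X in (_ <= X)%N]/= leqW ?leq_addl.
Qed.

Lemma vsize_req (j : 'I_n) : (vsize (enc_rat (req j)) <= N)%N.
Proof. by have := vsize_job j; apply: leq_trans; rewrite /=; lia. Qed.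

Lemma vsize_supply_qty (l : 'I_(nsupplies I)) : (vsize (enc_rat (supply_qty l)) <= N)%N.
Proof. by have := vsize_supply l; apply: leq_trans; rewrite /=; lia. Qed.

Lemma vsize_supply_time (l : 'I_(nsupplies I)) : (vsize (enc_rat (supply_time l)) <= N)%N.
Proof. by have := vsize_supply l; apply: leq_trans; rewrite /=; lia. Qed.

Lemma N_ge5 : (5 <= N)%N.
Proof.
apply: leq_trans (vsize_supply_qty (Ordinal (nsupplies_gt0 I))).
by have := bits_ge2 (numq (supply_qty (Ordinal (nsupplies_gt0 I))));
  have := bits_ge2 (denq (supply_qty (Ordinal (nsupplies_gt0 I)))); rewrite /=; lia.
Qed.

(** Arithmetic stands in for Boolean connectives: both summands are nonnegative, so their sum is
    nonzero exactly when the implication in [before] holds. *)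
Lemma eval_not_after st (i j : 'I_n) :
    st 5%N = enc_job j -> st 7%N = enc_job i ->
    st 8%N = Int j%:Z -> st 9%N = Int i%:Z ->
  truthy (eval st not_after) = before i j.
Proof.
move=> e5 e7 e8 e9; rewrite /not_after /before.
have fr (k : nat) (j' : 'I_n) : st k = enc_job j' ->
    fraction (eval st (Snd (Snd (Var k)))) (req j') N N.
  by move=> ek; rewrite /= ek; apply: fraction_enc; apply: vsize_req.
cbn [eval]; rewrite (eval_rat_le (fr _ _ e7) (fr _ _ e5)) (eval_rat_le (fr _ _ e5) (fr _ _ e7)).
rewrite e8 e9 /= lez_nat.
by case: (req i <= req j) => //; case: (req j <= req i) => //; case: (i <= j)%N.
Qed.

(** * Correctness of the loops *)

Lemma rank_body_spec st (i j : 'I_n) x k c :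
    st 5%N = enc_job j -> st 7%N = enc_job i ->
    st 8%N = Int j%:Z -> st 9%N = Int i%:Z ->
    partial_sum N (st 10%N) x k -> (k <= N)%N -> st 11%N = Int c%:Z -> (c <= N)%N ->
  safe M rank_body st /\
  [/\ partial_sum N (run rank_body st 10%N) (if before i j then req i + x else x) k.+1,
      run rank_body st 11%N = Int (if before i j then c.+1 else c)%:Z
    & run rank_body st 9%N = Int i.+1%:Z].
Proof.
move=> e5 e7 e8 e9 e10 kN e11 cN; rewrite /rank_body; cbn [safe run keep].
rewrite (eval_not_after e5 e7 e8 e9).
have iN : (bits i.+1%:Z <= M)%N.
  by apply: vsize_index; rewrite ltnS (leq_trans (ltnW (ltn_ord i))) ?size_jobs.
have succ (m : nat) : m%:Z + 1 = m.+1%:Z by rewrite -addn1 PoszD.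
case: (before i j).
  have e7' : eval st (Snd (Snd (Var 7))) = enc_rat (req i) by rewrite /= e7.
  have := partial_sumS (e := Var 10) kN e10 e7' (vsize_req i); rewrite addrC.
  move: (eval st (rat_add _ _)) => v sum.
  have vM := vsize_partial_sum (k := k.+1) (leq_trans kN (leqnn _)) sum.
  rewrite /update /= e11 e9 /= !succ; split=> //; split=> //; split=> //.
  exact: vsize_index.
rewrite /update /= e9 /= !succ; split; last by split=> //; apply: partial_sum_leq e10.
split=> //; apply: vsize_partial_sum e10; exact: leqW.
Qed.

Lemma rank_loop_spec st (j : 'I_n) :
    bounded M st -> st 1%N = enc_list [seq enc_job i | i <- enum 'I_n] ->
    st 5%N = enc_job j -> st 8%N = Int j%:Z ->
    st 10%N = Pair (Int 0) (Int 1) -> st 11%N = Int 0 -> st 9%N = Int 0 ->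
  safe M rank_loop st /\
  (partial_sum N (run rank_loop st 10%N) (\sum_(i < n | before i j) req i) n /\
   run rank_loop st 11%N = Int (rank j)%:Z).
Proof.
move=> bst e1 e5 e8 e10 e11 e9.
(* The size bound is charged for every job visited, whether or not its requirement was added. *)
pose G (pre : seq 'I_n) (st1 : store) :=
  [/\ partial_sum N (st1 10%N) (\sum_(i <- pre | before i j) req i) (size pre),
      st1 11%N = Int (count (before^~ j) pre)%:Z
    & st1 9%N = Int (size pre)%:Z].
have [|||safe_loop [Gsum Gcount _]] := run_for (x := 7) (l := 6) (e := Var 1)
  (c := rank_body) (G := G) (st := st) (js := enum 'I_n) (M := M) isT bst e1.
- exact: bst.
- rewrite /G /update /= e10 e11 e9 big_nil; split=> //; exact: partial_sum0.
- move=> pre i post st1 st2 ep _ fr keepG st2i [G10 G11 G9].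
  have szpre := ord_prefix_size ep.
  have preN : (size pre <= N)%N.
    by rewrite -szpre (leq_trans (ltnW (ltn_ord i))) // size_jobs.
  rewrite -!keepG // in G10 G11 G9; rewrite -szpre in G9.
  have countN := leq_trans (count_size (before^~ j) pre) preN.
  have e5' : st2 5%N = enc_job j by rewrite fr.
  have e8' : st2 8%N = Int j%:Z by rewrite fr.
  have [sb [H10 H11 H9]] := rank_body_spec e5' st2i e8' G9 G10 preN G11 countN.
  split=> //; rewrite /G size_rcons -szpre big_rcons_com; split=> //.
    by rewrite szpre.
  by rewrite H11 -cats1 count_cat /= addn0; case: (before i j); rewrite ?addn1 ?addn0.
split=> //; move: Gsum Gcount; rewrite -/rank_loop size_enum_ord big_enum_cond => Gsum ->.
by split=> //; rewrite -sum1_count big_enum_cond sum1_card.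
Qed.

Lemma vsize_enc_rat0 : (vsize (enc_rat 0) <= N)%N.
Proof. exact: N_ge5. Qed.

Lemma release_body_spec st (P : rat) (l : 'I_(nsupplies I)) r x k :
    st 7%N = enc_supply l -> partial_sum N (st 10%N) P n ->
    partial_sum N (st 12%N) x k -> (k <= N)%N ->
    st 13%N = enc_rat r -> (vsize (enc_rat r) <= N)%N ->
  safe M release_body st /\
  (partial_sum N (run release_body st 12%N) (supply_qty l + x) k.+1 /\
   run release_body st 13%N = enc_rat (if x < P then supply_time l else r)).
Proof.
move=> e7 e10 e12 kN e13 rN; rewrite /release_body; cbn [safe run keep].
rewrite (@eval_rat_le st (Var 10) (Var 12) _ _ _ _ _ _ e10 e12).
have NM : (N <= M)%N by rewrite size_boundE; lia.
have timeM := leq_trans (vsize_supply_time l) NM.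
set st1 := (X in eval X (rat_add _ _)); have {}e12 : partial_sum N (eval st1 (Var 12)) x k.
  by rewrite /= /st1; case: ifP.
have e7' : eval st1 (Snd (Var 7)) = enc_rat (supply_qty l).
  by rewrite /= /st1; case: ifP; rewrite /update /= e7.
have := partial_sumS kN e12 e7' (vsize_supply_qty l); rewrite addrC.
move: (eval st1 (rat_add _ _)) => v sum.
have vM := vsize_partial_sum (k := k.+1) (leq_trans kN (leqnn _)) sum.
rewrite /st1 {st1 e12 e7'}; case: lerP => _; rewrite /update /= ?e13 ?e7 //=.
by split=> //; split=> //; apply: leq_trans rN NM.
Qed.

Lemma release_loop_spec st (P : rat) :
    bounded M st -> st 2%N = enc_list [seq enc_supply l | l <- enum 'I_(nsupplies I)] ->
    partial_sum N (st 10%N) P n ->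
    st 12%N = Pair (Int 0) (Int 1) -> st 13%N = Pair (Int 0) (Int 1) ->
  safe M release_loop st /\ run release_loop st 13%N = enc_rat (release I P).
Proof.
move=> bst e2 e10 e12 e13.
pose G (pre : seq 'I_(nsupplies I)) (st1 : store) :=
  [/\ partial_sum N (st1 12%N) (\sum_(l <- pre) supply_qty l) (size pre),
      st1 13%N =
        enc_rat (\big[Num.max/0]_(l <- pre | supplied_before l < P) supply_time l)
    & (vsize (st1 13%N) <= N)%N].
have [|||safe_loop [_ Grel _]] := run_for (x := 7) (l := 6) (e := Var 2)
  (c := release_body) (G := G) (st := st) (js := enum 'I_(nsupplies I)) (M := M) isT bst e2.
- exact: bst.
- rewrite /G /update /= e12 e13 !big_nil; split=> //; first exact: partial_sum0.
  exact: vsize_enc_rat0.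
- move=> pre l post st1 st2 ep _ fr keepG st2l [G12 G13 G13N].
  have szpre := ord_prefix_size ep.
  have preN : (size pre <= N)%N.
    by rewrite -szpre (leq_trans (ltnW (ltn_ord l))) // size_supplies.
  rewrite -!keepG // in G12 G13 G13N; rewrite G13 in G13N.
  have e10' : partial_sum N (st2 10%N) P n by rewrite fr.
  have [sb [H12 H13]] := release_body_spec st2l e10' G12 preN G13 G13N.
  have beforeE : \sum_(m <- pre) supply_qty m = supplied_before l.
    rewrite big_uniq ?(uniq_ord_prefix ep) //=.
    by apply: eq_bigl => m; rewrite (mem_ord_prefix ep).
  rewrite beforeE in H13; split=> //; rewrite /G H13 size_rcons !big_rcons_com.
  split=> //; last by case: ifP => // _; apply: vsize_supply_time.
  (* Overwriting agrees with taking the maximum because the new supply is later than all previous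
     ones, and no earlier than the default 0, which is the first supply time. *)
  case: ifP => // _; congr enc_rat; apply/esym/max_idPl.
  rewrite big_seq_cond; apply: (big_ind (fun y => y <= supply_time l)) => [|x y xl yl|m].
  - rewrite -(supply_time0 I); apply: supply_time_mono.
    exact: leq0n.
  - by rewrite ge_max xl.
  - rewrite (mem_ord_prefix ep) => /andP[/ltnW ml _].
    exact: supply_time_mono.
by split=> //; rewrite Grel big_enum_cond.
Qed.

(** A release time is an input number or 0, so it is no longer than the input. *)
Lemma vsize_release P : (vsize (enc_rat (release I P)) <= N)%N.
Proof.
apply: (big_ind (fun y => (vsize (enc_rat y) <= N)%N)) => [|x y xN yN|l _].
- exact: vsize_enc_rat0.
- by case: leP.
- exact: vsize_supply_time.
Qed.

Lemma rank_le j : (rank j <= N)%N.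
Proof. by apply: leq_trans size_jobs; rewrite -[X in (_ <= X)%N]card_ord max_card. Qed.

Lemma vsize_ranked j : (vsize (enc_ranked j) <= N + N + 3)%N.
Proof.
rewrite /enc_ranked [vsize _]/=; have := bits_nat (rank j); have := rank_le j.
have := vsize_release (\sum_(i < n | before i j) req i); rewrite -/(ready j) /=.
lia.
Qed.

Lemma vsize_list_le (f : 'I_n -> value) (js : seq 'I_n) :
    (forall j, (vsize (f j) <= 3 * N + 5)%N) -> (size js <= n)%N ->
  (vsize (enc_list [seq f j | j <- js]) <= M)%N.
Proof.
move=> fN szj; have szN := leq_trans szj size_jobs.
apply: leq_trans (vsize_enc_list (b := 3 * N + 5) _) _.
  by move=> v; rewrite -map_comp => /mapP[j _ ->]; apply: fN.
rewrite size_map size_boundE.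
have : (size js * (3 * N + 5).+1 <= N * (3 * N + 5).+1)%N by rewrite leq_mul2r szN orbT.
by rewrite mulnS mulnDr mulnCA; lia.
Qed.

Lemma vsize_ranked_list (js : seq 'I_n) :
  (size js <= n)%N -> (vsize (enc_list [seq enc_ranked j | j <- js]) <= M)%N.
Proof. by apply: vsize_list_le => j; have := vsize_ranked j; lia. Qed.

Lemma vsize_small k : (k <= 5)%N -> (k <= M)%N.
Proof. by rewrite size_boundE; lia. Qed.

Lemma job_body_spec st (j : 'I_n) (js : seq 'I_n) :
    bounded M st -> st 1%N = enc_list [seq enc_job i | i <- enum 'I_n] ->
    st 2%N = enc_list [seq enc_supply l | l <- enum 'I_(nsupplies I)] ->
    st 5%N = enc_job j -> st 8%N = Int j%:Z -> (size js < n)%N ->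
    st 3%N = enc_list [seq enc_ranked i | i <- js] ->
  safe M job_body st /\
  (run job_body st 3%N = enc_list [seq enc_ranked i | i <- j :: js] /\
   run job_body st 8%N = Int j.+1%:Z).
Proof.
move=> bst e1 e2 e5 e8 szj e3; rewrite /job_body.
set c0 := SSeq (SAssign 10 _) _; set c2 := SSeq (SAssign 12 _) _.
cbn [safe run].
pose sa := run c0 st; rewrite -/sa.
have safe0 : safe M c0 st by split; [|split]; apply: vsize_small.
have bsa : bounded M sa := run_bounded bst safe0.
have [s1 [P1 R1]] := rank_loop_spec (st := sa) bsa e1 e5 e8 erefl erefl erefl.
pose sb := run rank_loop sa; rewrite -/sb in P1 R1 *.
have sbE y : y \notin writes rank_loop -> sb y = sa y by exact: run_frame.
have bsb : bounded M sb := run_bounded bsa s1.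
pose sc := run c2 sb; rewrite -/sc.
have safe2 : safe M c2 sb by split; apply: vsize_small.
have bsc : bounded M sc := run_bounded bsb safe2.
have sc2 : sc 2%N = enc_list [seq enc_supply l | l <- enum 'I_(nsupplies I)].
  by rewrite -e2 [LHS]sbE.
have [s3 R3] := release_loop_spec (st := sc) bsc sc2 P1 erefl erefl.
pose sd := run release_loop sc; rewrite -/sd in R3 *.
have sdE y : y \notin writes release_loop -> sd y = sc y by exact: run_frame.
have d3 : eval sd (Cons (Cons (Var 11) (Var 13)) (Var 3)) =
    enc_list [seq enc_ranked i | i <- j :: js].
  rewrite [LHS]/= R3 !sdE //; congr (Pair (Pair _ _) _); first exact: R1.
  exact: etrans (sbE 3%N isT) e3.
have d8 : sd 8%N = Int j%:Z by rewrite sdE // -e8; apply: sbE.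
rewrite d3.
have succ : j%:Z + 1 = j.+1%:Z by rewrite -addn1 PoszD.
rewrite /update /= d8 /= succ; split=> //; split=> //; split=> //; split=> //; split=> //.
split; first exact: (vsize_ranked_list (js := j :: js)).
by apply: vsize_index; rewrite ltnS (leq_trans (ltnW (ltn_ord j))) ?size_jobs.
Qed.

Lemma enc_ready_add i (m : nat) :
  enc_rat (ready i + m%:R) =
  Pair (Int (numq (ready i) + m%:Z * denq (ready i))) (Int (denq (ready i))).
Proof. exact: (enc_rat_add_int (ready i) m%:Z). Qed.

(** Stated for any list of jobs, it bounds the running maximum inside the loop as well as the final
    start time. *)
Lemma vsize_candidates (js : seq 'I_n) j :
  (vsize (enc_rat (\big[Num.max/0]_(i <- js | (rank i <= rank j)%N)
     (ready i + (rank j - rank i)%:R))%R) <= 3 * N + 5)%N.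
Proof.
apply: (big_ind (fun y => (vsize (enc_rat y) <= 3 * N + 5)%N)) => [|x y xN yN|i _].
- by apply: leq_trans vsize_enc_rat0 _; lia.
- by case: leP.
rewrite enc_ready_add [vsize _]/=.
have := bits_add (numq (ready i)) ((rank j - rank i)%:Z * denq (ready i)).
have := bits_mul (rank j - rank i)%:Z (denq (ready i)).
have := bits_nat (rank j - rank i); have := rank_le j.
have := vsize_release (\sum_(i' < n | before i' i) req i'); rewrite -/(ready i) /=.
lia.
Qed.

Lemma max_body_spec st (i j : 'I_n) y :
    bounded M st ->
    st 7%N = enc_ranked i -> st 5%N = enc_ranked j -> st 13%N = enc_rat y ->
    (vsize (enc_rat y) <= 3 * N + 5)%N ->
  safe M max_body st /\
  run max_body st 13%N =
    enc_rat (if (rank i <= rank j)%N then Num.max (ready i + (rank j - rank i)%:R) y else y).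
Proof.
move=> bst e7 e5 e13 yN; rewrite /max_body; cbn [safe run keep].
have eE : truthy (eval st (Le (Fst (Var 7)) (Fst (Var 5)))) = (rank i <= rank j)%N.
  by rewrite /= e7 e5 /= lez_nat; case: leqP.
rewrite eE; case: (leqP (rank i)) => ij; last first.
  by split; [exact: bst 13%N | exact: e13].
set cand := ready i + _.
have candE : eval st candidate = enc_rat cand.
  by rewrite enc_ready_add /= e7 e5 /= subzn.
have candN : (vsize (enc_rat cand) <= 3 * N + 5)%N.
  have := vsize_candidates [:: i] j; rewrite big_cons big_nil ij max_l //.
  by rewrite addr_ge0 ?release_ge0 ?ler0n.
have candM : (vsize (enc_rat cand) <= M)%N.
  by apply: leq_trans candN _; rewrite size_boundE; lia.
rewrite candE; set st1 := update _ _ _.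
have bst1 : bounded M st1 by apply: bounded_update.
have f13 : fraction (eval st1 (Var 13)) y (3 * N + 5) (3 * N + 5).
  by rewrite /= /st1 /update /= e13; apply: fraction_enc.
have f10 : fraction (eval st1 (Var 10)) cand (3 * N + 5) (3 * N + 5).
  by rewrite /= /st1 /update /=; apply: fraction_enc.
rewrite (eval_rat_le f13 f10).
have e13' : st1 13%N = enc_rat y by rewrite -e13.
have e10' : st1 10%N = enc_rat cand by [].
case: (leP y) => _.
  by split; [split; [exact: candM | exact: bst1 10%N] | exact: e10'].
by split; [split; [exact: candM | exact: bst1 13%N] | exact: e13'].
Qed.

Lemma max_loop_spec st (j : 'I_n) :
    bounded M st -> st 3%N = enc_list [seq enc_ranked i | i <- rev (enum 'I_n)] ->
    st 5%N = enc_ranked j -> st 13%N = Pair (Int 0) (Int 1) ->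
  safe M max_loop st /\ run max_loop st 13%N = enc_rat (start j).
Proof.
move=> bst e3 e5 e13.
pose G (pre : seq 'I_n) (st1 : store) := st1 13%N =
  enc_rat (\big[Num.max/0]_(i <- pre | (rank i <= rank j)%N)
             (ready i + (rank j - rank i)%:R)).
suff : safe M max_loop st /\ G (rev (enum 'I_n)) (run max_loop st).
  by rewrite /G (perm_big (enum 'I_n)) ?perm_rev // big_enum_cond.
apply: (run_for (enc := enc_ranked) (x := 7) (l := 6) (e := Var 3)
  (c := max_body) (G := G) (st := st) (js := rev (enum 'I_n)) (M := M)) => //.
- exact: bst 3%N.
- by rewrite /G /update /= e13 big_nil.
move=> pre i post st1 st2 ep bst2 fr keepG st2i G13.
rewrite /G -keepG // in G13; rewrite /G big_rcons_com.
apply: max_body_spec => //; first by rewrite fr.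
exact: vsize_candidates.
Qed.

Lemma scheduler_spec :
  safe M scheduler (input_store (enc_instance I)) /\
  run scheduler (input_store (enc_instance I)) 0%N = enc_schedule start.
Proof.
have NM : (N <= M)%N by rewrite size_boundE; lia.
set st := input_store _; rewrite /scheduler.
have bst : bounded M st.
  by move=> y; rewrite /st /input_store; case: ifP => // _; apply: vsize_small.
set c0 := SSeq (SSeq (SAssign 1 _) _) _.
cbn [safe run].
pose sa := run c0 st; rewrite -/sa.
have safe0 : safe M c0 st.
  split; last by split; apply: vsize_small.
  split; apply: leq_trans NM; first exact: (vsize_vfst (enc_instance I)).
  exact: (vsize_vsnd (enc_instance I)).
have bsa : bounded M sa := run_bounded bst safe0.
have sa1 : sa 1%N = enc_list [seq enc_job i | i <- enum 'I_n] by [].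
have sa2 : sa 2%N = enc_list [seq enc_supply l | l <- enum 'I_(nsupplies I)] by [].
(* Consing reverses the list of ranked jobs; the second loop conses again while traversing it, so
   the output is in index order. *)
pose G1 (pre : seq 'I_n) (st1 : store) :=
  st1 3%N = enc_list [seq enc_ranked i | i <- rev pre] /\ st1 8%N = Int (size pre)%:Z.
have [|||s1 [G3 _]] := run_for (x := 5) (l := 4) (e := Var 1)
  (c := job_body) (G := G1) (st := sa) (js := enum 'I_n) (M := M) isT bsa sa1.
- exact: bsa.
- by [].
- move=> pre j post st1 st2 ep bst2 fr keepG st2j [G3 G8].
  have szpre := ord_prefix_size ep.
  rewrite -!keepG // in G3 G8; rewrite -szpre in G8.
  have e1' : st2 1%N = enc_list [seq enc_job i | i <- enum 'I_n] by rewrite fr.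
  have e2' : st2 2%N = enc_list [seq enc_supply l | l <- enum 'I_(nsupplies I)] by rewrite fr.
  have szj : (size (rev pre) < n)%N by rewrite size_rev -szpre.
  have [sj [H3 H8]] := job_body_spec bst2 e1' e2' st2j G8 szj G3.
  by split=> //; rewrite /G1 rev_rcons size_rcons -szpre.
set sb := run _ sa in G3 *; have bsb : bounded M sb := run_bounded bsa s1.
set sc := update sb 0%N _.
have bsc : bounded M sc by apply: bounded_update => //; apply: vsize_small.
have sc3 : sc 3%N = enc_list [seq enc_ranked i | i <- rev (enum 'I_n)] by [].
pose G2 (pre : seq 'I_n) (st1 : store) :=
  st1 0%N = enc_list [seq enc_rat (start i) | i <- rev pre].
have [|||s2 G0] := run_for (x := 5) (l := 4) (e := Var 3)
  (c := start_body) (G := G2) (st := sc) (js := rev (enum 'I_n)) (M := M) isT bsc sc3.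
- exact: bsc.
- by [].
- move=> pre j post st1 st2 ep bst2 fr keepG st2j G0.
  rewrite /G2 -keepG // in G0.
  have szj : (size (rev (rcons pre j)) <= n)%N.
    have : size (rev (enum 'I_n)) = n by rewrite size_rev size_enum_ord.
    by rewrite ep size_cat /= size_rev size_rcons; lia.
  rewrite /start_body; set c1 := SAssign 13 _; cbn [safe run].
  have safe1 : safe M c1 st2 by apply: vsize_small.
  have bs1 := run_bounded bst2 safe1; set s1' := run c1 st2 in bs1 *.
  have e3' : s1' 3%N = enc_list [seq enc_ranked i | i <- rev (enum 'I_n)] by rewrite -sc3 -fr.
  have [sm H13] := max_loop_spec (st := s1') bs1 e3' st2j erefl.
  have H0 : run max_loop s1' 0%N = enc_list [seq enc_rat (start i) | i <- rev pre].
    by rewrite run_frame.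
  have HE : eval (run max_loop s1') (Cons (Var 13) (Var 0)) =
     enc_list [seq enc_rat (start i) | i <- rev (rcons pre j)].
    by cbn [eval]; rewrite H13 H0 rev_rcons.
  rewrite HE; split=> //; split=> //; split=> //.
  apply: vsize_list_le szj => i.
  by have := vsize_candidates (enum 'I_n) i; rewrite big_enum_cond.
split; last by apply: etrans G0 _; rewrite revK.
by split; [exact: safe0 | split; [exact: s1 | split; [exact: vsize_small | exact: s2]]].
Qed.

(** * From ranks back to positions in an order *)

Lemma sum_before (s : 'S_n) (k : 'I_n) :
    (forall i j, before (s i) (s j) = (i <= j)%N) ->
  \sum_(i < n | before i (s k)) req i = prefix_req s k.
Proof.
move=> sP; rewrite (reindex_inj (@perm_inj _ s)) /prefix_req /=.
by apply: eq_bigl => i; rewrite sP.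
Qed.

Lemma rank_perm (s : 'S_n) (k : 'I_n) :
  (forall i j, before (s i) (s j) = (i <= j)%N) -> rank (s k) = k.+1.
Proof.
move=> sP; rewrite /rank -sum1_card (reindex_inj (@perm_inj _ s)) /=.
rewrite -[RHS](card_ord_lt (ltn_ord k)) -sum1_card.
by apply: eq_bigl => i; rewrite !inE sP ltnS.
Qed.

Lemma start_perm (s : 'S_n) (k : 'I_n) :
    (forall i j, before (s i) (s j) = (i <= j)%N) ->
  start (s k) = list_start s k.
Proof.
move=> sP; rewrite /start (reindex_inj (@perm_inj _ s)) /list_start /=.
by apply: eq_big => i; rewrite !rank_perm // /ready sum_before // subSS.
Qed.

Lemma before_perm : exists s : 'S_n, forall i j, before (s i) (s j) = (i <= j)%N.
Proof.
apply: sorting_perm.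
- move=> i j; rewrite /before.
  by case: (ltgtP (req i) (req j)) => //= _ /anti_leq/val_inj.
- move=> j i k; rewrite /before.
  case: (ltgtP (req i) (req j)) => [//|ij|ij] /=; case: (ltgtP (req j) (req k)) => [//|jk|jk] //=.
  + by move=> _ _; rewrite leNgt (lt_trans jk ij).
  + by move=> _ _; rewrite leNgt -jk ij.
  + by move=> _ _; rewrite leNgt ij jk.
  + by move=> ij' jk'; rewrite ij jk lexx (leq_trans ij' jk').
- move=> i j; rewrite /before.
  by case: (ltgtP (req i) (req j)) => //= _; apply: leq_total.
Qed.

End Program.

Definition size_bound_poly : {poly nat} := ('X + 1) ^+ 3 *+ 10.

Lemma horner_size_bound N : size_bound_poly.[N] = size_bound N.
Proof.
rewrite /size_bound_poly /size_bound horner_natMn; congr (10 * _)%N.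
rewrite !exprS expr0 !horner_natM horner_natD hornerX -[1]/(1%:P) !hornerC.
by rewrite -[1]/1%N addn1 muln1 !expnS expn0 muln1.
Qed.

Theorem theorem5 (R : realType) :
  (forall (I : instance) (s : 'S_(njobs I)),
     unit_proc_weight_eq_req I -> non_increasing_weight s ->
     (exists S : schedule R I, is_list_schedule s S) /\
     (forall S : schedule R I,
        is_list_schedule s S -> feasible_within_factor 3 S))
  /\
  (exists c : cmd,
     poly_time_scheduler c unit_proc_weight_eq_req
       (fun (I : instance) (S : 'I_(njobs I) -> rat) =>
          let SR : schedule R I := fun j => ratr (S j) in
          (exists2 s : 'S_(njobs I),
             non_increasing_weight s & is_list_schedule s SR) /\
          feasible_within_factor 3 SR)).
Proof.
split=> [I s [unit_proc weight_req] mono|].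
  split=> [|S lS]; last exact: list_schedule_3approx mono lS.
  by exists (list_schedule R s); apply: list_schedule_spec.
exists (compile scheduler), (time_bound scheduler size_bound_poly) => I [unit_proc weight_req].
have [safe_run out] := scheduler_spec I.
have [s sP] := before_perm I.
have mono : non_increasing_weight s.
  by move=> i k; rewrite -sP !weight_req /before; case: leP => [_ /andP[]|/ltW].
(* The order [s] is the one with ties broken by index, for which the computed starts are the closed
   form of the list schedule. *)
have lS : is_list_schedule s (fun j => ratr (start j) : R).
  by apply/is_list_scheduleP => // k; rewrite start_perm.
have [||t run_t t_le] := @exec_compile size_bound_poly (input_size I) scheduler
  (input_store (enc_instance I)) isT.
- rewrite horner_size_bound => y; rewrite /input_store.
  case: ifP => _; last exact: vsize_small.
  by rewrite size_boundE -/(input_size I); lia.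
- by rewrite horner_size_bound.
exists (@start I), t; split=> //; first by exists (run scheduler (input_store (enc_instance I))).
split; first by exists s.
exact: list_schedule_3approx mono lS.
Qed.
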